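(* The coefficients of the compositional inverse $g^{\langle -1 \rangle}(x)=x+b_1x^2+b_2x^3+\dots$ of $g(x)=x+a_1x^2+a_2x^3+\dots$ are determined by $$ b_n = \sum_{\pi \in NC(\mathtt{p}_n)} (-1)^{|\pi|}C_{(\overline{\pi}:\pi)}\,a_{|\pi_1|} a_{|\pi_2|} \dots a_{|\pi_r|}, $$ where $\pi=\{\pi_1,\dots,\pi_r\}$.
   Context: $\mathtt{p}_n=12\dots n$ denotes the standard path on $[n]$, and $NC(\mathtt{p}_n)$ is the set of noncrossing partitions of $[n]$ (partitions such that there are no $a<b<c<d$ with $a,c$ in one block and $b,d$ in a different block); $|\pi|$ is the number of blocks. The adjacent closure $\overline{\pi}$ of $\pi$ is the noncrossing partition obtained by successively merging any two blocks $\pi_i,\pi_j$ with $\max\pi_i+1=\min\pi_j$. Then $C_{(\overline{\pi}:\pi)}=\prod_{\pi'_i\in\overline{\pi}} C_{n_i}$, where $C_m$ is the $m$-th Catalan number and $n_i$ is the number of blocks of $\pi$ contained in the block $\pi'_i$ of $\overline{\pi}$. *)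

(* Defs.v *)
From mathcomp Require Import all_boot all_order all_algebra.

Set Implicit Arguments.
Unset Strict Implicit.
Unset Printing Implicit Defensive.

Import GRing.Theory.

Definition catalan (m : nat) : nat := 'C(m.*2, m) %/ m.+1.

(* The ground set [n] = {1, ..., n} is represented by 'I_n = {0, ..., n.-1};
   every condition below is invariant under this shift. *)
Section NoncrossingPartitions.

Variable n : nat.
Implicit Types (A B : {set 'I_n}) (P : {set {set 'I_n}}).

Definition crossing A B : bool :=
  [exists a : 'I_n, exists b : 'I_n, exists c : 'I_n, exists d : 'I_n,
     [&& a < b, b < c, c < d, a \in A, c \in A, b \in B & d \in B]].

Definition noncrossing P : bool :=
  [forall A in P, forall B in P, (A != B) ==> ~~ crossing A B].

Definition NC : {set {set {set 'I_n}}} :=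
  [set P | partition P [set: 'I_n] && noncrossing P].

(* The default values 0 and n are only reached on the empty set, which is
   never a block. *)
Definition block_max A : nat := \max_(i in A) i.
Definition block_min A : nat := \big[minn/n]_(i in A) i.

Definition adjacent A B : bool := (block_max A).+1 == block_min B.

Definition merge_blocks P A B : {set {set 'I_n}} :=
  (A :|: B) |: (P :\ A :\ B).

Definition adjacent_merge P : {set {set 'I_n}} :=
  if [pick AB : {set 'I_n} * {set 'I_n} |
        [&& AB.1 \in P, AB.2 \in P & adjacent AB.1 AB.2]] is Some AB
  then merge_blocks P AB.1 AB.2 else P.

(* Each effective merge lowers the number of blocks, so #|P| steps reach a
   partition without adjacent blocks. The result does not depend on the pairs
   picked: a block has at most one adjacent predecessor and one adjacent
   successor, and the block A :|: B inherits the predecessor of A and the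
   successor of B. *)
Definition adjacent_closure P : {set {set 'I_n}} := iter #|P| adjacent_merge P.

Definition catalan_closure P : nat :=
  \prod_(B in adjacent_closure P) catalan #|[set A in P | A \subset B]|.

End NoncrossingPartitions.

Local Open Scope ring_scope.

(* A formal power series is its coefficient sequence: f n = [x^n] f. *)
Section FormalPowerSeries.

Variable R : comNzRingType.
Implicit Types f g h : nat -> R.

Definition fps_one : nat -> R := fun n => (n == 0%N)%:R.
Definition fps_X : nat -> R := fun n => (n == 1%N)%:R.

Definition fps_mul f g : nat -> R :=
  fun n => \sum_(i < n.+1) f i * g (n - i)%N.

Definition fps_exp f (k : nat) : nat -> R := iter k (fps_mul f) fps_one.

(* Meaningful when g 0 = 0: then [x^n] g^k = 0 for k > n, and the sum over all
   k reduces to k <= n. *)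
Definition fps_comp f g : nat -> R :=
  fun n => \sum_(k < n.+1) f k * fps_exp g k n.

Definition compositional_inverse g h : Prop :=
  fps_comp g h =1 fps_X /\ fps_comp h g =1 fps_X.

(* x + a_1 x^2 + a_2 x^3 + ...; the value a 0 is not used. *)
Definition unit_series (a : nat -> R) : nat -> R :=
  fun n => match n with 0 => 0 | 1 => 1 | m.+2 => a m.+1 end.

End FormalPowerSeries.

(* Main.v *)
Require Import Defs.
From mathcomp Require Import all_boot all_order all_algebra.
From mathcomp Require Import zify ring.

Set Implicit Arguments.
Unset Strict Implicit.
Unset Printing Implicit Defensive.

Import GRing.Theory.

(* The outer blocks of a noncrossing partition of an interval tile that
   interval, hence form one chain of successively adjacent blocks, and every
   gap between consecutive elements of a block carries an arbitrary noncrossing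
   partition of its own. So, if W is the generating function of the right-hand
   sides (with W(0) = 1), C the Catalan series and
   U = \sum_k a_k x^k W^(k-1) the series of a single block, then W = C(-U).
   As C(t) = 1 + t C(t)^2, this reads W = 1 - \sum_k a_k x^k W^(k+1), i.e.
   g(x W) = x; that x W is also a left inverse follows by associativity of
   composition.

   The identity W = C(-U) is proved coefficientwise, by splitting off the least
   element x0 of the interval: either {x0} is a block, or x0 is removed from
   its block, whose next element j becomes the least element of a partition of
   what lies to the right of j. This requires weights in which the Catalan
   number of the first chain is replaced by an arbitrary function c of its
   length and the size of the first block is shifted by m. *)

(** * Chains of adjacent blocks *)

Section ChainMaps.

Variable M : nat.
Implicit Types (f : nat -> option (nat * nat)).

(* [f i = Some (e, w)] encodes a block of weight [w] with least element [i] and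
   greatest element [e.-1], so that the next block of the chain is found at
   [e]. *)
Definition chain_wf f := forall i e w, f i = Some (e, w) -> i < e <= M.

Definition ends_at f i i' := if f i' is Some (e, _) then e == i else false.

Definition chain_start f i := f i && ~~ [exists i' : 'I_M, ends_at f i i'].

(* [k] is fuel; [M] is always enough, see [chain_rec_fuel]. *)
Fixpoint chain_rec k f i :=
  if k is k'.+1 then if f i is Some (e, w) then w + chain_rec k' f e else 0
  else 0.

Definition chain_len f i := chain_rec M f i.

Lemma chain_wf_lt f i p : chain_wf f -> f i = Some p -> i < M.
Proof. by case: p => e w wf /wf; lia. Qed.

(** The index strictly increases along a chain and never exceeds [M], so [M - i] steps already reach
    the end. *)
Lemma chain_rec_fuel f k k' i : chain_wf f -> M <= i + k -> M <= i + k' ->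
  chain_rec k f i = chain_rec k' f i.
Proof.
move=> wf; elim: k k' i => [|k IH] [|k'] i //= H H'; case E: (f i) => [[e w]|] //.
- by have := wf _ _ _ E; lia.
- by have := wf _ _ _ E; lia.
- by have := wf _ _ _ E => lt; congr (_ + _); apply: IH; lia.
Qed.

Lemma chain_lenE f i : chain_wf f ->
  chain_len f i = if f i is Some (e, w) then w + chain_len f e else 0.
Proof.
move=> wf; rewrite /chain_len.
rewrite (@chain_rec_fuel _ M M.+1) //=; try lia.
Qed.

(** The chain from [i] never leaves [D], which is closed under passing to the next block; the
    induction is on [M - i]. *)
Lemma eq_chain_len f f' i (D : pred nat) : chain_wf f -> chain_wf f' -> D i ->
    (forall j, D j -> f j = f' j) ->
    (forall j e w, D j -> f j = Some (e, w) -> D e) ->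
  chain_len f i = chain_len f' i.
Proof.
move=> wf wf' Di eqf clo.
have [k le_k] : exists k, M - i <= k by exists (M - i).
elim: k i Di le_k => [|k IH] i Di le_k; rewrite !chain_lenE // -eqf //;
  case E: (f i) => [[e w]|] //; have lt := wf _ _ _ E.
- by lia.
- by congr (_ + _); apply: IH; [apply: clo E|lia].
Qed.

(** Well-formedness keeps every block below [M], so the bounded quantifier of [chain_start] misses
    no predecessor. *)
Lemma chain_startP f i : chain_wf f ->
  reflect (f i /\ forall i', ~~ ends_at f i i') (chain_start f i).
Proof.
move=> wf; apply: (iffP andP) => -[fi H]; split=> //.
- move=> i'; apply/negP => e_i; case/negP: H; apply/existsP.
  have lt : i' < M.
    by move: e_i; rewrite /ends_at; case E: (f i') => [[e w]|] // _; have := wf _ _ _ E; lia.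
  by exists (Ordinal lt).
- by rewrite negb_exists; apply/forallP.
Qed.

Definition chain_weight f (D : pred nat) :=
  \prod_(i < M | D i && chain_start f i) catalan (chain_len f i).

(** The predecessor may sit at different indices in the two maps, as happens when blocks are merged
    or a minimum moves; only its existence matters. *)
Lemma eq_chain_start f f' i : chain_wf f -> chain_wf f' ->
  (f i = f' i :> bool) ->
  (f i -> forall i', ends_at f i i' -> exists j, ends_at f' i j) ->
  (f' i -> forall i', ends_at f' i i' -> exists j, ends_at f i j) ->
  chain_start f i = chain_start f' i.
Proof.
move=> wf wf' eqi H H'; apply/(chain_startP _ wf)/(chain_startP _ wf') => -[fi E].
- split=> [|i']; first by rewrite -eqi.
  by rewrite eqi in fi; apply/negP => /(H' fi)[j]; apply/negP.
- split=> [|i']; first by rewrite eqi.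
  by rewrite -eqi in fi; apply/negP => /(H fi)[j]; apply/negP.
Qed.

(** A block at [lo] has no predecessor, because nothing lies below it, so it starts a chain whose
    factor can be split off. *)
Lemma chain_weight_first f lo : chain_wf f ->
    (forall i, i < lo -> f i = None) ->
  chain_weight f predT =
  catalan (chain_len f lo) * chain_weight f (predC1 lo).
Proof.
move=> wf sup; rewrite /chain_weight.
case E: (f lo) => [[e w]|].
- have lt : lo < M by apply: chain_wf_lt E.
  rewrite (bigD1 (Ordinal lt)) /=; last first.
    apply/(chain_startP _ wf); split=> [|i']; first by rewrite E.
    rewrite /ends_at; case E': (f i') => [[e' w']|] //.
    have := wf _ _ _ E'; have [/sup|] := ltnP i' lo; first by rewrite E'.
    by lia.
  by congr (_ * _); apply: eq_bigl => i; rewrite andbC.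
(* With no block at [lo] the chain is empty, and its factor is [catalan 0], that is 1. *)
rewrite chain_lenE // E /catalan bin0 divn1 mul1n.
apply: eq_bigl => i /=; case: eqP => //= ->.
by rewrite /chain_start E.
Qed.

(** The singleton at [lo] is put in front of the chain, possibly empty, that starts at [lo.+1]; the
    other chains are untouched. *)
Lemma chain_weight_cons f f' lo : chain_wf f -> chain_wf f' ->
    f lo = Some (lo.+1, 1) -> (forall i, i != lo -> f i = f' i) ->
    (forall i, i <= lo -> f' i = None) ->
  chain_len f lo = (chain_len f' lo.+1).+1 /\
  chain_weight f (predC1 lo) = chain_weight f' (predC1 lo.+1).
Proof.
move=> wf wf' flo eqf sup.
have eql i : lo < i -> chain_len f i = chain_len f' i.
  move=> lt; apply: (@eq_chain_len _ _ _ (fun i => lo < i)) => // [j lt_j|j e w lt_j].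
    by apply: eqf; lia.
  by move/wf; lia.
split; first by rewrite chain_lenE // flo add1n eql.
apply: eq_big => [i|i /= /andP[ne /andP[fi _]]].
  rewrite /=; case: (eqVneq (val i) lo) => [e|ne] /=.
    by rewrite /chain_start e sup // andbF.
  case: (eqVneq (val i) lo.+1) => [e|ne'] /=.
    apply/negP => /(chain_startP _ wf)[_ /(_ lo)].
    by rewrite /ends_at flo e eqxx.
  apply: eq_chain_start => //; first by rewrite eqf.
    move=> _ i'; rewrite /ends_at; case: (eqVneq i' lo) => [->|ne2].
      by rewrite flo => /eqP e; rewrite e eqxx in ne'.
    by rewrite eqf // => H; exists i'.
  move=> _ i'; rewrite /ends_at; case: (leqP i' lo) => [le|lt]; first by rewrite sup.
  by rewrite -eqf => [H|]; [exists i'|lia].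
rewrite eql //; rewrite ltnNge leq_eqVlt negb_or ne /=.
by apply/negP => lt; move: fi; rewrite eqf // sup // ltnW.
Qed.

(** The first block of [f'] is extended from [j] down to [lo], and [q] fills the gap. The first
    chain keeps its length because the end of its first block does not move. The chains of [q] stay
    separate: they end at [j] at the latest, where [f] has no block. *)
Lemma chain_weight_glue f q f' lo j : lo < j ->
    chain_wf f -> chain_wf q -> chain_wf f' ->
    f lo = f' j -> f j = None -> (forall i, i < lo -> f i = None) ->
    (forall i, lo < i < j -> f i = q i) -> (forall i, j < i -> f i = f' i) ->
    (forall i, i <= lo -> q i = None) -> (forall i, j <= i -> q i = None) ->
    (forall i e w, q i = Some (e, w) -> e <= j) ->
    (forall i, i < j -> f' i = None) ->
  chain_len f lo = chain_len f' j /\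
  chain_weight f (predC1 lo) = chain_weight q predT * chain_weight f' (predC1 j).
Proof.
move=> lt wf wq wf' flo fj f0 fq ff' q0 q1 qe f'0.
have eql' i : j < i -> chain_len f i = chain_len f' i.
  move=> lti; apply: (@eq_chain_len _ _ _ (fun i => j < i)) => // [i' e w lt'].
  by move/wf; lia.
(* The bound [j] is included because a chain of [q] may run up to [j]; both maps are undefined
   there. *)
have eqlq i : lo < i <= j -> chain_len f i = chain_len q i.
  move=> lti; apply: (@eq_chain_len _ _ _ (fun i => lo < i <= j)) => //.
    move=> i' /andP[lt' ]; rewrite leq_eqVlt => /orP[/eqP->|lt2]; first by rewrite fj q1.
    by rewrite fq // lt'.
  move=> i' e w /andP[lt' ]; rewrite leq_eqVlt => /orP[/eqP->|lt2]; first by rewrite fj.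
  rewrite fq ?lt' // => E; have := wq _ _ _ E; have := qe _ _ _ E; lia.
split.
  rewrite !chain_lenE // flo; case E: (f' j) => [[e w]|] //.
  by congr (_ + _); apply: eql'; have := wf' _ _ _ E; lia.
have stq (i : 'I_M) : lo < i < j -> chain_start f i = chain_start q i.
  move=> lti; apply: eq_chain_start => //; first by rewrite fq.
    move=> _ i'; rewrite /ends_at => H; exists i'; move: H.
    case: (ltngtP i' lo) => [lt'|lt'|->]; first by rewrite f0.
      case: (ltngtP i' j) => [lt2|lt2|->]; first by rewrite fq ?lt' ?lt2.
        by case E: (f i') => [[e w]|] //; have := wf _ _ _ E; lia.
      by rewrite fj.
    by rewrite flo; case E: (f' j) => [[e w]|] //; have := wf' _ _ _ E; lia.
  move=> _ i'; rewrite /ends_at => H; exists i'; move: H.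
  case: (leqP i' lo) => [lt'|lt']; first by rewrite q0.
  case: (leqP j i') => [lt2|lt2]; first by rewrite q1.
  by rewrite fq ?lt' ?lt2.
(* The block at [lo] in [f] and the block at [j] in [f'] end at the same place, so each replaces the
   other as a predecessor. *)
have stf (i : 'I_M) : j < i -> chain_start f i = chain_start f' i.
  move=> lti; apply: eq_chain_start => //; first by rewrite ff'.
    move=> _ i'; rewrite /ends_at => H.
    case: (ltngtP i' lo) => [lt'|lt'|e]; first by rewrite f0 in H.
      exists i'; move: H.
      case: (ltngtP i' j) => [lt2|lt2|->]; last by rewrite fj.
        rewrite fq ?lt' ?lt2 //.
        by case E: (q i') => [[e w]|] //; have := qe _ _ _ E; lia.
      by rewrite ff'.
    by exists j; rewrite -flo -e.
  move=> _ i'; rewrite /ends_at.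
  case: (ltngtP i' j) => [lt'|lt'|->]; first by rewrite f'0.
    by rewrite -ff' // => H; exists i'.
  by rewrite -flo => H; exists lo.
rewrite {1}/chain_weight (bigID (fun i : 'I_M => i < j)) /=; congr (_ * _).
  apply: eq_big => [i|i /andP[/andP[ne /andP[fi _]] ltj]].
    case: (ltngtP i lo) => [lt'|lt'|e] /=.
    - by rewrite /chain_start f0 // q0 // ltnW.
    - case: (ltnP i j) => ltj; first by rewrite andbT stq // lt'.
      by rewrite andbF /chain_start q1.
    - by rewrite /chain_start q0 // e.
  rewrite eqlq //; case: (ltngtP i lo) ne fi => //; last by lia.
  by move=> /f0->.
apply: eq_big => [i|i /andP[/andP[ne /andP[fi _]] ltj]] /=.
  case: (ltngtP i j) => lt' /=; first by rewrite andbF /chain_start f'0.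
    by rewrite stf // andbT; case: eqP => //; lia.
  by rewrite /chain_start lt' fj andbF.
rewrite eql' //; rewrite ltn_neqAle [_ <= _]leqNgt ltj andbT.
by apply/negP => /eqP e; rewrite -e fj in fi.
Qed.

(** The weights add up, so a chain through the merged block keeps its length; the index [e0] that
    disappears was not a start, since the block at [i0] ends there. *)
Lemma chain_weight_merge f f' i0 e0 w0 e1 w1 : chain_wf f -> chain_wf f' ->
    (forall i i' e w w', f i = Some (e, w) -> f i' = Some (e, w') -> i = i') ->
    f i0 = Some (e0, w0) -> f e0 = Some (e1, w1) ->
    f' i0 = Some (e1, w0 + w1) -> f' e0 = None ->
    (forall i, i != i0 -> i != e0 -> f' i = f i) ->
  chain_weight f' predT = chain_weight f predT.
Proof.
move=> wf wf' inj E0 E1 E0' E1' eqf.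
have lt0 := wf _ _ _ E0.
have eql i : i != e0 -> chain_len f' i = chain_len f i.
  have [k le_k] : exists k, M - i <= k by exists (M - i).
  elim: k i le_k => [|k IH] i le_k ne.
    rewrite !chain_lenE //; case E: (f' i) => [[e w]|]; first by have := wf' _ _ _ E; lia.
    by case E': (f i) => [[e w]|] //; have := wf _ _ _ E'; lia.
  rewrite chain_lenE // [RHS]chain_lenE //.
  case: (eqVneq i i0) => [e|ne'].
    rewrite e E0' E0 chain_lenE // [chain_len f e0]chain_lenE // E1.
    rewrite -addnA; congr (_ + (_ + _)).
    rewrite -!chain_lenE //; have := wf _ _ _ E1 => lt1.
    by apply: IH; lia.
  rewrite eqf //; case E: (f i) => [[e w]|] //; congr (_ + _); apply: IH.
    by have := wf _ _ _ E; lia.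
  (* By injectivity of the ends, only the block at [i0] leads to [e0]. *)
  by apply/eqP=> e_e; rewrite e_e in E; rewrite (inj _ _ _ _ _ E E0) eqxx in ne'.
apply: eq_big => [i|i /andP[_ /andP[fi _]]] /=; last first.
  by rewrite eql //; apply/negP => /eqP e; rewrite e E1' in fi.
case: (eqVneq (val i) e0) => [e|ne].
  rewrite [LHS]/chain_start e E1' /=; apply/esym/negP => /(chain_startP _ wf)[_ /(_ i0)].
  by rewrite /ends_at E0 eqxx.
apply: eq_chain_start => //.
- by case: (eqVneq (val i) i0) => [->|ne']; rewrite ?E0 ?E0' ?eqf.
- move=> _ i'; rewrite /ends_at; case: (eqVneq i' i0) => [->|ne'].
    by rewrite E0' => H; exists e0; rewrite E1.
  case: (eqVneq i' e0) => [->|ne2]; first by rewrite E1'.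
  by rewrite eqf // => H; exists i'.
- move=> _ i'; rewrite /ends_at; case: (eqVneq i' i0) => [->|ne'].
    by rewrite E0 => /eqP e; rewrite e eqxx in ne.
  case: (eqVneq i' e0) => [->|ne2]; first by rewrite E1 => H; exists i0; rewrite E0'.
  by rewrite -eqf // => H; exists i'.
Qed.

End ChainMaps.

(** * Chains of a partition and its adjacent closure *)

Section Blocks.

Variable n : nat.
Implicit Types (A B D : {set 'I_n}) (P Q : {set {set 'I_n}}).

Lemma block_min_eq A (x : 'I_n) :
  x \in A -> {in A, forall y : 'I_n, x <= y} -> block_min A = x.
Proof.
move=> xA le; apply/eqP; rewrite /block_min eqn_leq; apply/andP; split.
  have: x \in index_enum _ by rewrite mem_index_enum.
  elim: (index_enum _) => [|y s IH]; rewrite // inE big_cons.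
  case/predU1P => [<-|/IH]; first by rewrite xA geq_minl.
  by case: ifP => // _ ?; rewrite geq_min; apply/orP; right.
(* The default value [n] of the minimum lies above [x]. *)
elim/big_ind: _ => [|u v|y /le //]; first exact: ltnW.
by rewrite leq_min => -> ->.
Qed.

Lemma block_max_eq A (x : 'I_n) :
  x \in A -> {in A, forall y : 'I_n, y <= x} -> block_max A = x.
Proof.
move=> xA le; apply/eqP; rewrite /block_max eqn_leq; apply/andP; split.
  exact/bigmax_leqP.
exact: leq_bigmax_cond.
Qed.

Lemma block_minP A : A != set0 ->
  exists x : 'I_n, [/\ x \in A, block_min A = x & {in A, forall y : 'I_n, x <= y}].
Proof.
case/set0Pn => x0 x0A.
case: (arg_minnP (fun y : 'I_n => val y) x0A) => x xA le.
by exists x; split=> //; apply: block_min_eq.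
Qed.

Lemma block_maxP A : A != set0 ->
  exists x : 'I_n, [/\ x \in A, block_max A = x & {in A, forall y : 'I_n, y <= x}].
Proof.
case/set0Pn => x0 x0A.
case: (arg_maxnP (fun y : 'I_n => val y) x0A) => x xA le.
by exists x; split=> //; apply: block_max_eq.
Qed.

Lemma block_min_le A (x : 'I_n) : x \in A -> block_min A <= x.
Proof.
move=> xA; have /block_minP[y [_ -> ->]] // : A != set0 by apply/set0Pn; exists x.
Qed.

Lemma block_max_ge A (x : 'I_n) : x \in A -> x <= block_max A.
Proof.
move=> xA; have /block_maxP[y [_ -> ->]] // : A != set0 by apply/set0Pn; exists x.
Qed.

Lemma block_neq0 P D A : partition P D -> A \in P -> A != set0.
Proof. by case/and3P => _ _ P0 AP; apply: contraNneq P0 => <-. Qed.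

Lemma block_eq P D A B x : partition P D ->
  A \in P -> B \in P -> x \in A -> x \in B -> A = B.
Proof.
case/and3P => _ tI _ AP BP xA xB.
by rewrite -(def_pblock tI AP xA) -(def_pblock tI BP xB).
Qed.

Lemma block_min_inj P D A B : partition P D ->
  A \in P -> B \in P -> block_min A = block_min B -> A = B.
Proof.
move=> pP AP BP; have /block_minP[x [xA -> _]] := block_neq0 pP AP.
have /block_minP[y [yB -> _]] := block_neq0 pP BP.
by move/val_inj => e; rewrite -e in yB; apply: block_eq pP _ _ xA yB.
Qed.

Lemma block_max_inj P D A B : partition P D ->
  A \in P -> B \in P -> block_max A = block_max B -> A = B.
Proof.
move=> pP AP BP; have /block_maxP[x [xA -> _]] := block_neq0 pP AP.
have /block_maxP[y [yB -> _]] := block_neq0 pP BP.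
by move/val_inj => e; rewrite -e in yB; apply: block_eq pP _ _ xA yB.
Qed.

(** The weight [nu] is constantly 1 for the original partition and counts original blocks once
    blocks have been merged. *)
Definition chain_map (nu : {set 'I_n} -> nat) P (i : nat) : option (nat * nat) :=
  omap (fun A => ((block_max A).+1, nu A)) [pick A in P | block_min A == i].

Lemma chain_map_block nu P D A : partition P D -> A \in P ->
  chain_map nu P (block_min A) = Some ((block_max A).+1, nu A).
Proof.
move=> pP AP; rewrite /chain_map; case: pickP => [B /andP[BP /eqP e]|/(_ A)] /=.
  by rewrite (block_min_inj pP BP AP e).
by rewrite AP eqxx.
Qed.

Lemma chain_map_some nu P i e w : chain_map nu P i = Some (e, w) ->
  exists A, [/\ A \in P, block_min A = i, (block_max A).+1 = e & nu A = w].
Proof.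
rewrite /chain_map; case: pickP => [B /andP[BP /eqP eB]|] //= [<- <-].
by exists B.
Qed.

Lemma chain_map_none nu P i : (forall A, A \in P -> block_min A <> i) ->
  chain_map nu P i = None.
Proof.
by move=> H; rewrite /chain_map; case: pickP => [B /andP[/H ne /eqP]|].
Qed.

Lemma chain_map_wf nu P D : partition P D -> chain_wf n (chain_map nu P).
Proof.
move=> pP i e w /chain_map_some[A [AP <- <- _]].
have /block_minP[x [xA -> _]] := block_neq0 pP AP.
have /block_maxP[y [yA -> H]] := block_neq0 pP AP.
by rewrite ltn_ord andbT ltnS H.
Qed.

Lemma eq_chain_map nu nu' P : {in P, nu =1 nu'} ->
  chain_map nu P =1 chain_map nu' P.
Proof.
by move=> E i; rewrite /chain_map; case: pickP => //= A /andP[/E-> _].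
Qed.

Section Merge.

Variables (P : {set {set 'I_n}}) (D A B : {set 'I_n}).
Hypotheses (pP : partition P D) (AP : A \in P) (BP : B \in P).
Hypothesis adjAB : adjacent A B.

Lemma adjacent_neq : A != B.
Proof.
apply/eqP => e; move: adjAB; rewrite /adjacent e.
have /set0Pn[x xB] := block_neq0 pP BP.
by have := block_min_le xB; have := block_max_ge xB; lia.
Qed.

Lemma merge_partition : partition (merge_blocks P A B) D.
Proof.
have [/eqP cD tI P0] := and3P pP.
apply/and3P; split.
- apply/eqP; rewrite -cD; apply/setP => x; apply/bigcupP/bigcupP => -[C].
    case/setU1P => [->|].
      by case/setUP => xC; [exists A|exists B].
    by rewrite !inE => /and3P[_ _ CP] xC; exists C.
  move=> CP xC; have [eB|neB] := eqVneq C B.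
    by exists (A :|: B); rewrite ?setU11 // inE -eB xC orbT.
  have [eA|neA] := eqVneq C A.
    by exists (A :|: B); rewrite ?setU11 // inE -eA xC.
  by exists C => //; rewrite !inE neA neB CP orbT.
- apply/trivIsetP => C1 C2; rewrite !inE.
  have dis C : [&& C != B, C != A & C \in P] -> [disjoint A :|: B & C].
    case/and3P => neB neA CP; rewrite -setI_eq0 setIUl setU_eq0 !setI_eq0.
    by rewrite !(trivIsetP tI) // eq_sym.
  case/predU1P => [->|C1P]; case/predU1P => [->|C2P] ne.
  + by rewrite eqxx in ne.
  + exact: dis.
  + by rewrite disjoint_sym dis.
  + by case/and3P: C1P => _ _ C1P; case/and3P: C2P => _ _ C2P; apply: (trivIsetP tI).
- rewrite !inE negb_or (negbTE P0) !andbF andbT.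
  by apply: contraNneq (block_neq0 pP AP) => /esym/eqP; rewrite setU_eq0 => /andP[].
Qed.

Lemma card_merge : #|merge_blocks P A B| < #|P|.
Proof.
rewrite /merge_blocks cardsU1 (cardsD1 A P) AP (cardsD1 B (P :\ A)).
have -> : B \in P :\ A by rewrite !inE eq_sym adjacent_neq.
by rewrite !add1n ltnS -[leqRHS]add1n leq_add2r leq_b1.
Qed.

Lemma merge_min : block_min (A :|: B) = block_min A.
Proof.
have /block_minP[x [xA -> Hx]] := block_neq0 pP AP.
apply: block_min_eq => [|y /setUP[/Hx//|yB]]; first by rewrite inE xA.
have := block_min_le yB; have := block_max_ge xA; move: adjAB.
by rewrite /adjacent => /eqP; lia.
Qed.

Lemma merge_max : block_max (A :|: B) = block_max B.
Proof.
have /block_maxP[x [xB -> Hx]] := block_neq0 pP BP.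
apply: block_max_eq => [|y /setUP[yA|/Hx//]]; first by rewrite inE xB orbT.
have := block_min_le xB; have := block_max_ge yA; move: adjAB.
by rewrite /adjacent => /eqP; lia.
Qed.

Lemma merge_chain_weight nu : nu (A :|: B) = nu A + nu B ->
  chain_weight n (chain_map nu (merge_blocks P A B)) predT =
  chain_weight n (chain_map nu P) predT.
Proof.
move=> nuU; have pM := merge_partition.
have adjE : block_min B = (block_max A).+1 by apply/esym/eqP.
apply: (@chain_weight_merge n _ _ (block_min A) (block_min B) (nu A)
          (block_max B).+1 (nu B)).
- exact: chain_map_wf pP.
- exact: chain_map_wf pM.
- move=> i i' e w w' /chain_map_some[C [CP <- <- _]].
  case/chain_map_some => C' [C'P <- [e'] _].
  by rewrite (block_max_inj pP C'P CP e').
- by rewrite (chain_map_block _ pP) // adjE.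
- by rewrite (chain_map_block _ pP).
- by rewrite -merge_min (chain_map_block _ pM) ?setU11 // merge_max nuU.
- apply: chain_map_none => C; rewrite !inE => /predU1P[->|/and3P[neB neA CP]].
    rewrite merge_min => /(block_min_inj pP AP BP); exact/eqP/adjacent_neq.
  by move/(block_min_inj pP CP BP)/eqP; apply/negP.
- move=> i neA neB; case E: (chain_map nu P i) => [[e w]|].
    case/chain_map_some: E => C [CP iE <- <-].
    rewrite -iE (chain_map_block _ pM) // !inE CP andbT.
    by apply/orP; right; apply/andP; split; [apply: contraNneq neB|apply: contraNneq neA] => <-; rewrite iE.
  apply: chain_map_none => C; rewrite !inE => /predU1P[->|/and3P[_ _ CP]] iE.
    by rewrite -iE merge_min eqxx in neA.
  by move: E; rewrite -iE (chain_map_block _ pP).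
Qed.

End Merge.

Definition closed_partition P :=
  forall A B, A \in P -> B \in P -> ~~ adjacent A B.

(** Without adjacent pairs, every block is a chain of its own, whose length is the weight of the
    block. *)
Lemma closed_chain_weight nu P D : partition P D -> closed_partition P ->
  chain_weight n (chain_map nu P) predT = \prod_(A in P) catalan (nu A).
Proof.
move=> pP clP; have wf := @chain_map_wf nu _ _ pP.
(* Each block has exactly one minimum, and each index is the minimum of at most one block, which
   turns the product over blocks into one over indices. *)
transitivity (\prod_(A in P) \prod_(i < n | block_min A == i) catalan (nu A)); last first.
  apply: eq_bigr => A AP; have /block_minP[x [_ -> _]] := block_neq0 pP AP.
  by rewrite (big_pred1 x) // => i; rewrite eq_sym.
rewrite (exchange_big_dep predT) //= /chain_weight big_mkcond /=.
apply: eq_bigr => i _; case: ifP => [/(chain_startP _ wf)[]|].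
  case E: (chain_map nu P i) => [[e w]|] // _ _.
  rewrite chain_lenE // E; case/chain_map_some: E => A [AP Ai <- <-].
  rewrite (big_pred1 A) => [|B]; last first.
    apply/andP/eqP => [[BP /eqP Bi]|->]; last by rewrite Ai.
    by apply: block_min_inj pP BP AP _; rewrite Ai.
  rewrite chain_lenE // chain_map_none ?addn0 // => B BP e'.
  by have := clP A B AP BP; rewrite /adjacent e' eqxx.
move=> nst; rewrite big_pred0 // => A; apply/andP => -[AP /eqP Ai].
case/negP: nst; apply/(chain_startP _ wf); split=> [|i'].
  by rewrite -Ai (chain_map_block _ pP).
rewrite /ends_at; case E: (chain_map nu P i') => [[e w]|] //.
case/chain_map_some: E => B [BP _ <- _].
by have := clP B A BP AP; rewrite /adjacent Ai.
Qed.

Lemma adjacent_mergeP P D : partition P D ->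
  closed_partition P /\ adjacent_merge P = P \/
  exists A B, [/\ A \in P, B \in P, adjacent A B &
                 adjacent_merge P = merge_blocks P A B].
Proof.
move=> pP; rewrite /adjacent_merge; case: pickP => [[A B] /= /and3P[AP BP AB]|no].
  by right; exists A, B.
by left; split=> // A B AP BP; have := no (A, B); rewrite /= AP BP /= => ->.
Qed.

(* Weighting a block of an intermediate partition by the number of original
   blocks inside makes the chain weight invariant under merging. *)
Lemma iter_mergeP P D k : partition P D ->
  let Q := iter k (@adjacent_merge n) P in
  let nu B := #|[set A in P | A \subset B]| in
  [/\ partition Q D, {in P, forall A, exists2 B, B \in Q & A \subset B},
      chain_weight n (chain_map nu Q) predT = chain_weight n (chain_map nu P) predT &
      closed_partition Q \/ #|Q| + k <= #|P|].
Proof.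
move=> pP /=; elim: k => [|k [pQ PQ wQ cQ]] /=.
  by split=> //; [move=> A AP; exists A|right; rewrite addn0].
set Q := iter k _ P in pQ PQ wQ cQ *.
have [[clQ ->]|[A [B [AQ BQ AB ->]]]] := adjacent_mergeP pQ.
  by split=> //; left.
have pM := merge_partition pQ AQ BQ.
split=> //.
- move=> C /PQ[E EQ CE].
  have [e|ne] := eqVneq E A.
    by exists (A :|: B); rewrite ?setU11 // subsetU // -e CE.
  have [e|ne'] := eqVneq E B.
    by exists (A :|: B); rewrite ?setU11 // subsetU // -e CE orbT.
  by exists E => //; rewrite !inE ne ne' EQ orbT.
- rewrite -wQ; apply: (merge_chain_weight pQ AQ BQ AB).
  (* No block of [P] is inside both [A] and [B]: it is nonempty, while distinct blocks of [Q] are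
     disjoint. *)
  rewrite -cardsUI [X in _ + X](_ : _ = 0) ?addn0; last first.
    apply/eqP; rewrite cards_eq0 -subset0; apply/subsetP => C; rewrite !inE.
    case/andP => /andP[CP CA] /andP[_ CB].
    have /set0Pn[x xC] := block_neq0 pP CP.
    have e := block_eq pQ AQ BQ (subsetP CA _ xC) (subsetP CB _ xC).
    by have := adjacent_neq pQ AQ BQ AB; rewrite e eqxx.
  apply: eq_card => C; rewrite !inE -andb_orr; case CP: (C \in P) => //=.
  apply/idP/orP => [CAB|[]]; last 2 first.
  + by move/subset_trans; apply; apply: subsetUl.
  + by move/subset_trans; apply; apply: subsetUr.
  (* [C] lies in a single block [E] of [Q], which must be whichever of [A] and [B] it meets. *)
  have [E EQ CE] := PQ _ CP; have /set0Pn[x xC] := block_neq0 pP CP.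
  have xE := subsetP CE _ xC.
  case/setUP: (subsetP CAB _ xC) => [xA|xB].
    by left; rewrite (block_eq pQ AQ EQ xA xE).
  by right; rewrite (block_eq pQ BQ EQ xB xE).
- right; case: cQ => [/(_ A B AQ BQ)|le]; first by rewrite AB.
  by apply: leq_trans le; rewrite addnS ltn_add2r (card_merge pQ AQ BQ AB).
Qed.

(** Merging preserves the chain weight, and on the fully merged partition this weight is the Catalan
    product. On [P] itself all weights are 1, since a block of [P] contains no block of [P] but
    itself. *)
Lemma catalan_closureE P D : partition P D ->
  catalan_closure P = chain_weight n (chain_map (fun=> 1) P) predT.
Proof.
move=> pP; have [pQ _ wQ cQ] := iter_mergeP #|P| pP.
rewrite /catalan_closure /adjacent_closure -(closed_chain_weight _ pQ); last first.
  (* After [#|P|] effective merges the cardinality bound leaves no block at all, and the empty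
     partition is closed. *)
  case: cQ => // le A B; set Q := iter _ _ _ in le *.
  move: le; rewrite addnC -[leqRHS]addn0 leq_add2l leqn0 cards_eq0 => /eqP->.
  by rewrite inE.
rewrite wQ; have E := @eq_chain_map (fun B => #|[set A in P | A \subset B]|) (fun=> 1) P _.
have {}E: chain_map (fun B => #|[set A in P | A \subset B]|) P =1 chain_map (fun=> 1) P.
  apply: E => B BP; rewrite /= (_ : [set A in P | _] = [set B]) ?cards1 //.
  apply/setP => A; rewrite !inE; apply/andP/eqP => [[AP AB]|->] //.
  have /set0Pn[x xA] := block_neq0 pP AP.
  exact: block_eq pP AP BP xA (subsetP AB _ xA).
have wf := @chain_map_wf (fun=> 1) _ _ pP.
have wf' := @chain_map_wf (fun B => #|[set A in P | A \subset B]|) _ _ pP.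
apply: eq_big => [i|i _] /=.
  by apply: eq_chain_start => //; rewrite ?E // => _ i' H; exists i'; move: H; rewrite /ends_at E.
by congr catalan; apply: (@eq_chain_len _ _ _ _ predT).
Qed.

End Blocks.

(** * Splitting off the least element *)

Ltac nat_lia :=
  intros; repeat match goal with H : ?T |- _ =>
    lazymatch T with
    | is_true (leq _ _) => fail
    | is_true (andb _ _) => fail
    | is_true (negb _) => fail
    | @eq nat _ _ => fail
    | nat => fail
    | _ => clear H
    end end; lia.

Section Decomposition.

Variable n : nat.
Implicit Types (A B D : {set 'I_n}) (P Q : {set {set 'I_n}}).

Definition itv (lo hi : nat) : {set 'I_n} := [set i : 'I_n | lo <= i < hi].

Definition NC_on D : {set {set {set 'I_n}}} :=
  [set P | partition P D && noncrossing P].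

(** The elementwise form in which the cutting and gluing of partitions below is checked. *)
Lemma NC_onP P D : reflect
  [/\ forall A, A \in P -> A != set0,
      forall A x, A \in P -> x \in A -> x \in D,
      forall x, x \in D -> exists2 A, A \in P & x \in A,
      forall A B x, A \in P -> B \in P -> x \in A -> x \in B -> A = B &
      forall A B (a b c d : 'I_n), A \in P -> B \in P -> A != B ->
        a < b -> b < c -> c < d -> a \in A -> c \in A -> b \in B -> d \in B ->
        False]
  (P \in NC_on D).
Proof.
rewrite inE; apply: (iffP andP) => [[pP /forall_inP nc]|[H0 HD HC HI HX]].
  have [/eqP cD _ _] := and3P pP.
  split.
  - by move=> A; apply: block_neq0 pP.
  - by move=> A x AP xA; rewrite -cD; apply/bigcupP; exists A.
  - by move=> x; rewrite -cD => /bigcupP[A AP xA]; exists A.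
  - by move=> A B x; apply: block_eq pP.
  - move=> A B a b c d AP BP ne ab bc cd aA cA bB dB.
    have /forall_inP /(_ B BP) := nc A AP; rewrite ne => /existsP[].
    exists a; apply/existsP; exists b; apply/existsP; exists c; apply/existsP.
    by exists d; apply/and5P; split=> //; apply/and3P.
split; last first.
  apply/forall_inP => A AP; apply/forall_inP => B BP; apply/implyP => ne.
  apply/existsP => -[a /existsP[b /existsP[c /existsP[d]]]].
  case/and5P => ab bc cd aA /and3P[cA bB dB].
  exact: HX ab bc cd aA cA bB dB.
apply/and3P; split.
- apply/eqP/setP => x; apply/bigcupP/idP => [[A AP xA]|/HC[A AP xA]].
    exact: HD xA.
  by exists A.
- apply/trivIsetP => A B AP BP ne; rewrite -setI_eq0; apply/eqP/setP => x.
  by rewrite !inE; apply/andP => -[xA xB]; rewrite (HI A B x) ?eqxx in ne.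
- by apply/negP => /H0; rewrite eqxx.
Qed.

Lemma NC_on_part P D : P \in NC_on D -> partition P D.
Proof. by rewrite inE => /andP[]. Qed.

Lemma NC_on0 : NC_on set0 = [set set0].
Proof.
apply/setP => P; rewrite !inE partition_set0; case: eqP => // -> /=.
by apply/forall_inP => A; rewrite inE.
Qed.

Lemma block_pblock P D A x : partition P D -> A \in P -> x \in A ->
  pblock P x = A.
Proof. by case/and3P => _ tI _; apply: def_pblock. Qed.

Variables (x0 : 'I_n) (hi : nat).
Hypothesis lt_hi : x0 < hi.

Lemma mem_itv lo h (x : 'I_n) : (x \in itv lo h) = (lo <= x < h).
Proof. by rewrite inE. Qed.

Lemma singleton_notin P : P \in NC_on (itv x0.+1 hi) -> [set x0] \notin P.
Proof.
case/NC_onP => _ HD _ _ _; apply/negP => /HD /(_ (set11 _)).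
by rewrite mem_itv ltnn.
Qed.

(** A singleton crosses nothing, because a crossing takes two distinct elements of each block. *)
Lemma NC_cons P : P \in NC_on (itv x0.+1 hi) ->
  [set x0] |: P \in NC_on (itv x0 hi).
Proof.
move=> /NC_onP[H0 HD HC HI HX].
have n0 A : A \in P -> x0 \in A -> False.
  by move=> AP /(HD _ _ AP); rewrite mem_itv ltnn.
apply/NC_onP; split.
- by move=> A /setU1P[->|/H0//]; apply/set0Pn; exists x0; rewrite inE.
- move=> A x /setU1P[->|AP xA]; first by rewrite inE => /eqP->; rewrite mem_itv leqnn.
  by have := HD _ _ AP xA; rewrite !mem_itv => /andP[/ltnW-> ->].
- move=> x; rewrite mem_itv => H; have [->|ne] := eqVneq x x0.
    by exists [set x0]; rewrite ?setU11 ?inE.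
  have [|A AP xA] := HC x; last by exists A; rewrite ?setU1r.
  rewrite mem_itv; case/andP: H => le ->; rewrite andbT ltn_neqAle le andbT.
  by rewrite eq_sym; apply: contraNneq ne => /val_inj->.
- move=> A B x /setU1P[->|AP] /setU1P[->|BP] //; last exact: HI.
    by rewrite inE => /eqP-> /(n0 _ BP).
  by move=> xA; rewrite inE => /eqP e; rewrite e in xA; case: (n0 _ AP).
- move=> A B a b c d /setU1P[->|AP] /setU1P[->|BP]; last exact: HX.
  + by rewrite eqxx.
  + by move=> _ ab bc cd; rewrite !inE => /eqP ea /eqP ec; move: ab bc; rewrite ea ec; nat_lia.
  + by move=> _ ab bc cd _ _; rewrite !inE => /eqP ea /eqP ec; move: bc cd; rewrite ea ec; nat_lia.
Qed.

Lemma NC_uncons P : P \in NC_on (itv x0 hi) -> [set x0] \in P ->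
  P :\ [set x0] \in NC_on (itv x0.+1 hi).
Proof.
move=> /NC_onP[H0 HD HC HI HX] x0P.
apply/NC_onP; split.
- by move=> A /setD1P[_ /H0].
- move=> A x /setD1P[ne AP] xA; have := HD _ _ AP xA; rewrite !mem_itv.
  case/andP => le ->; rewrite andbT ltn_neqAle le andbT.
  apply: contraNneq ne => /val_inj e; apply/eqP; apply: (HI _ _ x0) => //.
    by rewrite e.
  by rewrite inE.
- move=> x; rewrite mem_itv => /andP[lt lt']; have [|A AP xA] := HC x.
    by rewrite mem_itv ltnW.
  exists A => //; rewrite !inE AP andbT; apply/eqP => e; move: xA lt.
  by rewrite e inE => /eqP->; rewrite ltnn.
- by move=> A B x /setD1P[_ AP] /setD1P[_ BP]; apply: HI.
- by move=> A B a b c d /setD1P[_ AP] /setD1P[_ BP]; apply: HX.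
Qed.

Section Successor.

Variable j : 'I_n.
Hypotheses (lt_j : x0 < j) (lt_jhi : j < hi).

Definition succ_in_block P :=
  (j \in pblock P x0) && [forall k in pblock P x0, (x0 < k) ==> (j <= k)].

(** [Q] lives strictly between [x0] and [j], [P] from [j] on, and [x0] joins the block of [j]. The
    two definitions that follow recover [Q] and [P]. *)
Definition glue Q P :=
  (x0 |: pblock P j) |: (Q :|: (P :\ pblock P j)).

Definition unglue_inner P := [set A in P | A \subset itv x0.+1 j].

Definition unglue_outer P :=
  (pblock P x0 :\ x0) |: [set A in P | A \subset itv j.+1 hi].

Section Unglue.

Variable P : {set {set 'I_n}}.
Hypotheses (ncP : P \in NC_on (itv x0 hi)) (sP : succ_in_block P).

Let A0 := pblock P x0.

Lemma unglue_block : [/\ A0 \in P, x0 \in A0, j \in A0 &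
  forall k : 'I_n, k \in A0 -> x0 < k -> j <= k].
Proof.
have pP := NC_on_part ncP.
have x0c : x0 \in cover P.
  by have /and3P[/eqP-> _ _] := pP; rewrite mem_itv leqnn.
split; first exact: pblock_mem.
- by rewrite mem_pblock.
- by case/andP: sP.
- by move=> k kA lt; case/andP: sP => _ /forall_inP /(_ k kA); rewrite lt.
Qed.

(** A block with an element [z] in the gap and an element [y] beyond [j] would cross [A0], as
    [x0 < z < j < y]. *)
Lemma unglue_dichotomy A : A \in P -> A != A0 ->
  A \subset itv x0.+1 j \/ A \subset itv j.+1 hi.
Proof.
move=> AP ne; have [A0P x0A0 jA0 min_j] := unglue_block.
have /NC_onP[H0 HD HC HI HX] := ncP.
have gt y : y \in A -> x0 < y < hi /\ val y != j.
  move=> yA; have := HD _ _ AP yA; rewrite mem_itv => /andP[le ->].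
  rewrite ltn_neqAle le !andbT.
  split; apply: contraNneq ne => /val_inj e; apply/eqP; apply: HI yA _ => //.
    by rewrite -e.
  by rewrite e.
have [s|/subsetPn[y yA ny]] := boolP (A \subset itv x0.+1 j); first by left.
right; apply/subsetP => z zA.
have [/andP[lt1 lt2] ne1] := gt y yA; have [/andP[lt3 lt4] ne2] := gt z zA.
rewrite mem_itv lt4 andbT ltnNge leq_eqVlt (negbTE ne2) /=; apply/negP => ltz.
apply: (HX A0 A x0 z j y) => //; first by rewrite eq_sym.
by move: ny; rewrite mem_itv lt1 /= -leqNgt leq_eqVlt eq_sym (negbTE ne1).
Qed.

Lemma unglue_innerP : unglue_inner P \in NC_on (itv x0.+1 j).
Proof.
have [A0P x0A0 jA0 min_j] := unglue_block.
have /NC_onP[H0 HD HC HI HX] := ncP.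
apply/NC_onP; split.
- by move=> A; rewrite inE => /andP[/H0].
- by move=> A x; rewrite inE => /andP[_ /subsetP]; apply.
- move=> x; rewrite mem_itv => /andP[lt lt'].
  have [|A AP xA] := HC x; first by rewrite mem_itv (ltnW lt) (ltn_trans lt').
  exists A => //; rewrite inE AP /=.
  (* An element of the gap is not in [A0], since [j] is the next element of [A0] after [x0]. *)
  have [e|/(unglue_dichotomy AP)[//|]] := eqVneq A A0.
    by move: xA; rewrite e => /min_j /(_ lt); rewrite leqNgt lt'.
  by move/subsetP/(_ x xA); rewrite mem_itv ltnNge (ltnW lt').
- by move=> A B x; rewrite !inE => /andP[AP _] /andP[BP _]; apply: HI.
- by move=> A B a b c d; rewrite !inE => /andP[AP _] /andP[BP _]; apply: HX.
Qed.

Lemma unglue_outerP : unglue_outer P \in NC_on (itv j hi).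
Proof.
have [A0P x0A0 jA0 min_j] := unglue_block.
have /NC_onP[H0 HD HC HI HX] := ncP.
have jA : j \in A0 :\ x0.
  by rewrite !inE jA0 andbT; apply/eqP => e; move: lt_j; rewrite e ltnn.
have sup A : A \in unglue_outer P -> A = A0 :\ x0 \/ A \in P /\ A \subset itv j.+1 hi.
  by rewrite !inE => /predU1P[->|/andP[AP s]]; [left|right].
have ninA0 A : A \subset itv j.+1 hi -> A <> A0.
  by move=> /subsetP s e; have := s j; rewrite e jA0 mem_itv ltnn => /(_ isT).
have ltA0 x : x \in A0 :\ x0 -> j <= x < hi.
  rewrite !inE => /andP[ne xA].
  have := HD _ _ A0P xA; rewrite mem_itv => /andP[le ->]; rewrite andbT.
  apply: min_j => //; rewrite ltn_neqAle le andbT eq_sym.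
  by apply: contraNneq ne => /val_inj->.
apply/NC_onP; split.
- by move=> A /sup[->|[/H0]//]; apply/set0Pn; exists j.
- move=> A x /sup[->|[AP /subsetP s] /s]; rewrite !mem_itv; first exact: ltA0.
  by case/andP => /ltnW-> ->.
- move=> x; rewrite mem_itv => /andP[le lt].
  have [|A AP xA] := HC x.
    by rewrite mem_itv lt andbT (leq_trans (ltnW lt_j)).
  have [e|/(unglue_dichotomy AP)[/subsetP s|s]] := eqVneq A A0.
  + exists (A0 :\ x0); first exact: setU11.
    by rewrite inE -e xA andbT inE; apply: contraTneq lt_j => <-; rewrite -leqNgt.
  + by have := s x xA; rewrite mem_itv; nat_lia.
  + by exists A; rewrite // setU1r // inE AP.
- move=> A B x /sup[->|[AP As]] /sup[->|[BP Bs]] //; last exact: HI.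
    rewrite !inE => /andP[_ xA] xB.
    by case: (ninA0 _ Bs); apply: HI xB xA.
  rewrite !inE => xA /andP[_ xB].
  by case: (ninA0 _ As); apply: HI xA xB.
(* A crossing with [A0] deprived of [x0] is already a crossing with [A0]. *)
- have sub y : y \in A0 :\ x0 -> y \in A0 by rewrite !inE => /andP[].
  move=> A B a b c d /sup[->|[AP As]] /sup[->|[BP Bs]] ne ab bc cd.
  + by rewrite eqxx in ne.
  + move=> /sub aA /sub cA bB dB; apply: (HX A0 B a b c d) => //.
    by apply/eqP => /esym; apply: ninA0.
  + move=> aA cA /sub bB /sub dB; apply: (HX A A0 a b c d) => //.
    exact/eqP/ninA0.
  + exact: HX ab bc cd.
Qed.

Lemma unglueK : glue (unglue_inner P) (unglue_outer P) = P.
Proof.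
have [A0P x0A0 jA0 min_j] := unglue_block.
have /NC_onP[H0 HD HC HI HX] := ncP.
have jA : j \in A0 :\ x0.
  by rewrite !inE jA0 andbT; apply/eqP => e; move: lt_j; rewrite e ltnn.
have e : pblock (unglue_outer P) j = A0 :\ x0.
  by apply: (block_pblock (NC_on_part unglue_outerP)) => //; rewrite setU11.
have A0o : A0 :\ x0 \notin [set A in P | A \subset itv j.+1 hi].
  rewrite inE negb_and; apply/orP; right; apply/subsetPn; exists j => //.
  by rewrite mem_itv ltnn.
rewrite /glue e setD1K // /unglue_outer setU1K //.
apply/setP => A; rewrite !inE; apply/idP/idP => [|AP].
  by case/or3P => [/eqP->//|/andP[]//|/andP[]].
have [//|/(unglue_dichotomy AP)[]] := eqVneq A A0 => s; rewrite AP s ?orbT //.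
Qed.

End Unglue.

Section Glue.

Variables P Q : {set {set 'I_n}}.
Hypotheses (ncQ : Q \in NC_on (itv x0.+1 j)) (ncP : P \in NC_on (itv j hi)).

Let A1 := pblock P j.

Lemma glue_block : A1 \in P /\ j \in A1.
Proof.
have pP := NC_on_part ncP.
have jc : j \in cover P by have /and3P[/eqP-> _ _] := pP; rewrite mem_itv leqnn.
by split; [apply: pblock_mem|rewrite mem_pblock].
Qed.

Lemma mem_glue A : A \in glue Q P ->
  [\/ A = x0 |: A1, A \in Q | A \in P /\ A != A1].
Proof.
rewrite !inE => /predU1P[->|/orP[AQ|/andP[ne AP]]].
- by constructor 1.
- by constructor 2.
- by constructor 3.
Qed.

Lemma glue_bounds : [/\ forall A x, A \in Q -> x \in A -> x0 < x < j,
  forall A x, A \in P -> x \in A -> j <= x < hi,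
  forall x, x \in x0 |: A1 -> x = x0 \/ j <= x < hi /\ x \in A1
  & forall x, x \in A1 -> x \in x0 |: A1].
Proof.
have [AP jA] := glue_block.
have /NC_onP[_ QD _ _ _] := ncQ; have /NC_onP[_ PD _ _ _] := ncP.
split.
- by move=> A x /QD H /H; rewrite mem_itv.
- by move=> A x /PD H /H; rewrite mem_itv.
- move=> x /setU1P[->|xA]; [by left|right; split=> //].
  by have := PD _ _ AP xA; rewrite mem_itv.
- by move=> x xA; rewrite inE xA orbT.
Qed.

(** Blocks of [Q] lie strictly between the consecutive elements [x0] and [j] of the enlarged block,
    hence cross nothing outside [Q]. If another block of [P] crossed the enlarged block, it would
    cross [A1] too, with [j] taking the place of [x0]. *)
Lemma glueP : glue Q P \in NC_on (itv x0 hi).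
Proof.
have [A1P jA1] := glue_block; have [bQ bP b1 s1] := glue_bounds.
have /NC_onP[Q0 QD QC QI QX] := ncQ; have /NC_onP[P0 PD PC PI PX] := ncP.
apply/NC_onP; split.
- move=> A /mem_glue[->|/Q0//|[/P0]//]; apply/set0Pn; exists x0; exact: setU11.
- move=> A x /mem_glue[->|AQ|[AP _]] xA; rewrite mem_itv.
  + by case: (b1 _ xA) => [->|[]]; [rewrite leqnn|nat_lia].
  + by have := bQ _ _ AQ xA; nat_lia.
  + by have := bP _ _ AP xA; nat_lia.
- move=> x; rewrite mem_itv => xD; have [->|ne] := eqVneq x x0.
    by exists (x0 |: A1); rewrite setU11.
  have lt : x0 < x.
    rewrite ltn_neqAle; case/andP: xD => -> _; rewrite andbT eq_sym.
    by apply: contraNneq ne => /val_inj->.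
  have [ltxj|lejx] := ltnP x j.
    have [|A AQ xA] := QC x; first by rewrite mem_itv lt.
    by exists A; rewrite // !inE AQ orbT.
  have [|A AP xA] := PC x; first by rewrite mem_itv lejx; case/andP: xD.
  have [e|neA] := eqVneq A A1.
    by exists (x0 |: A1); rewrite ?setU11 // s1 -?e.
  by exists A; rewrite // !inE AP neA !orbT.
- move=> A B x /mem_glue[->|AQ|[AP neA]] /mem_glue[->|BQ|[BP neB]] xA xB //.
  + by have := bQ _ _ BQ xB; case: (b1 _ xA) => [->|[]]; nat_lia.
  + case: (b1 _ xA) => [e|[_ x1]]; first by have := bP _ _ BP xB; rewrite e; nat_lia.
    by case/eqP: neB; apply: PI xB x1.
  + by have := bQ _ _ AQ xA; case: (b1 _ xB) => [->|[]]; nat_lia.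
  + exact: QI xA xB.
  + by have := bQ _ _ AQ xA; have := bP _ _ BP xB; nat_lia.
  + case: (b1 _ xB) => [e|[_ x1]]; first by have := bP _ _ AP xA; rewrite e; nat_lia.
    by case/eqP: neA; apply: PI xA x1.
  + by have := bP _ _ AP xA; have := bQ _ _ BQ xB; nat_lia.
  + exact: PI xA xB.
- move=> A B a b c d /mem_glue[->|AQ|[AP neA]] /mem_glue[->|BQ|[BP neB]] ne
    ab bc cd aA cA bB dB.
  + by rewrite eqxx in ne.
  + have := bQ _ _ BQ bB; have := bQ _ _ BQ dB.
    by move: bc; case: (b1 _ cA) => [->|[]]; nat_lia.
  + have cA1 : c \in A1.
      by case: (b1 _ cA) => [e|[] //]; move: ab bc; rewrite e; case: (b1 _ aA) => [->|[]]; nat_lia.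
    have := bP _ _ BP bB; case/andP; rewrite leq_eqVlt => /predU1P[/val_inj e|ltb] _.
      by case/eqP: neB; apply: PI bB _; rewrite -?e.
    apply: (PX A1 B j b c d) => //; by rewrite eq_sym.
  + have := bQ _ _ AQ aA; have := bQ _ _ AQ cA.
    by move: ab bc; case: (b1 _ bB) => [->|[]]; nat_lia.
  + exact: QX ne ab bc cd _ _ _ _.
  + by have := bQ _ _ AQ cA; have := bP _ _ BP bB; nat_lia.
  + have lea := bP _ _ AP aA.
    case: (b1 _ bB) => [e|[_ b1']]; first by move: ab; rewrite e; nat_lia.
    case: (b1 _ dB) => [e|[_ d1']]; first by move: ab bc cd; rewrite e; nat_lia.
    exact: (PX A A1 a b c d).
  + by have := bP _ _ AP aA; have := bQ _ _ BQ bB; nat_lia.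
  + exact: PX ne ab bc cd _ _ _ _.
Qed.

Lemma pblock_glue : pblock (glue Q P) x0 = x0 |: A1.
Proof. by apply: (block_pblock (NC_on_part glueP)); rewrite setU11. Qed.

Lemma succ_glue : succ_in_block (glue Q P).
Proof.
have [A1P jA1] := glue_block; have [bQ bP b1 s1] := glue_bounds.
rewrite /succ_in_block pblock_glue s1 //=; apply/forall_inP => k /b1[->|[]].
  by rewrite ltnn.
by case/andP => ->; rewrite implybT.
Qed.

Lemma glueK : (unglue_inner (glue Q P), unglue_outer (glue Q P)) = (Q, P).
Proof.
have [A1P jA1] := glue_block; have [bQ bP b1 s1] := glue_bounds.
have /NC_onP[Q0 QD QC QI QX] := ncQ; have /NC_onP[P0 PD PC PI PX] := ncP.
congr (_, _); apply/setP => A.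
  rewrite inE; apply/andP/idP => [[/mem_glue[->|//|[AP _]] /subsetP s]|AQ].
  - by have := s x0 (setU11 _ _); rewrite mem_itv ltnn.
  - have /set0Pn[x xA] := P0 _ AP.
    by have := s x xA; have := bP _ _ AP xA; rewrite mem_itv; nat_lia.
  - rewrite !inE AQ orbT; split=> //; apply/subsetP => x; exact: QD.
rewrite /unglue_outer pblock_glue setU1K; last first.
  by apply/negP => /(bP _ _ A1P); nat_lia.
rewrite !inE; apply/predU1P/idP => [[->//|/andP[AG /subsetP s]]|AP].
  have /mem_glue[e|AQ|[]//] : A \in glue Q P by rewrite !inE.
  - by have := s x0; rewrite e setU11 mem_itv => /(_ isT); nat_lia.
  - have /set0Pn[x xA] := Q0 _ AQ.
    by have := s x xA; have := bQ _ _ AQ xA; rewrite mem_itv; nat_lia.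
have [->|ne] := eqVneq A A1; [by left|right].
apply/andP; split; first by rewrite AP !orbT.
apply/subsetP => x xA; have := bP _ _ AP xA; rewrite mem_itv.
case/andP; rewrite leq_eqVlt => /predU1P[/val_inj e|-> ->//].
by case/eqP: ne; apply: PI xA _; rewrite -?e.
Qed.

End Glue.
End Successor.
End Decomposition.

(** * Weighted sums over noncrossing partitions and their recursion *)

Section WeightedSums.

Variables (R : comNzRingType) (a : nat -> R).

Local Open Scope ring_scope.

(* The least element of the ground set is [lo], so [lo] is where the first
   chain starts and the block with minimum [lo] is the one of shifted size. *)
Definition nc_weight n (c : nat -> R) m lo (P : {set {set 'I_n}}) : R :=
  c (chain_len n (chain_map (fun=> 1%N) P) lo)
  * (chain_weight n (chain_map (fun=> 1%N) P) (predC1 lo))%:R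
  * \prod_(A in P) - a (#|A| + m * (block_min A == lo))%N.

Definition nc_sum n (c : nat -> R) m lo hi : R :=
  \sum_(P in NC_on (itv n lo hi)) nc_weight c m lo P.

Definition cat_coef (r : nat) : R := (catalan r)%:R.

Lemma chain_map_eq n (P P' : {set {set 'I_n}}) i :
    (forall A, block_min A = i -> (A \in P) = (A \in P')) ->
  chain_map (fun=> 1%N) P i = chain_map (fun=> 1%N) P' i.
Proof.
move=> E; rewrite /chain_map; congr omap; apply: eq_pick => A /=.
by case: eqP => [/E->|]; rewrite ?andbF.
Qed.

Lemma nc_sum_empty n c m lo : nc_sum n c m lo lo = c 0%N.
Proof.
have e : itv n lo lo = set0.
  by apply/setP => i; rewrite !inE; apply/negP => /andP[]; rewrite leqNgt => /negP.
rewrite /nc_sum e NC_on0 big_set1 /nc_weight big_set0 mulr1.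
have N i : chain_map (fun=> 1%N) (set0 : {set {set 'I_n}}) i = None.
  by apply: chain_map_none => A; rewrite inE.
have wf : chain_wf n (chain_map (fun=> 1%N) (set0 : {set {set 'I_n}})).
  by move=> i e' w; rewrite N.
rewrite chain_lenE // N /chain_weight big_pred0 ?mulr1 // => i.
by rewrite /chain_start N andbF.
Qed.

Lemma chain_map_below n lo hi (P : {set {set 'I_n}}) i :
  P \in NC_on (itv n lo hi) -> (i < lo)%N ->
  chain_map (fun=> 1%N) P i = None.
Proof.
case/NC_onP => P0 PD _ _ _ lt; apply: chain_map_none => A AP.
have /block_minP[x [xA -> _]] := P0 _ AP.
by have := PD _ _ AP xA; rewrite mem_itv; nat_lia.
Qed.

Lemma block_min_ge n lo hi (P : {set {set 'I_n}}) A :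
  P \in NC_on (itv n lo hi) -> A \in P -> (lo <= block_min A < hi)%N.
Proof.
case/NC_onP => P0 PD _ _ _ AP.
have /block_minP[x [xA -> _]] := P0 _ AP.
by have := PD _ _ AP xA; rewrite mem_itv.
Qed.

Lemma block_max_lt n lo hi (P : {set {set 'I_n}}) A :
  P \in NC_on (itv n lo hi) -> A \in P -> (lo <= block_max A < hi)%N.
Proof.
case/NC_onP => P0 PD _ _ _ AP.
have /block_maxP[x [xA -> _]] := P0 _ AP.
by have := PD _ _ AP xA; rewrite mem_itv.
Qed.

Section Recursion.

Variables (n : nat) (x0 : 'I_n) (hi : nat).
Hypothesis lt_hi : (x0 < hi)%N.

(** The singleton lengthens the first chain by one, whence [c \o succn]. It also absorbs the size
    shift [m], so that the first block of what remains is not shifted. *)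
Lemma nc_weight_cons c m P : P \in NC_on (itv n x0.+1 hi) ->
  nc_weight c m x0 ([set x0] |: P) =
  - a m.+1 * nc_weight (c \o succn) 0 x0.+1 P.
Proof.
move=> ncP; have ncP' := NC_cons lt_hi ncP; have nin := singleton_notin ncP.
have wf := chain_map_wf (nu := fun=> 1%N) (NC_on_part ncP).
have wf' := chain_map_wf (nu := fun=> 1%N) (NC_on_part ncP').
have min1 : block_min [set x0] = x0.
  by apply: block_min_eq => [|y]; rewrite inE // => /eqP->.
have max1 : block_max [set x0] = x0.
  by apply: block_max_eq => [|y]; rewrite inE // => /eqP->.
have [] := chain_weight_cons (lo := x0) wf' wf.
- have := chain_map_block (fun=> 1%N) (NC_on_part ncP') (setU11 [set x0] P).
  by rewrite min1 max1.
- move=> i ne; apply: chain_map_eq => A Ai; rewrite !inE; case: eqP => // e.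
  by rewrite -Ai e min1 eqxx in ne.
- by move=> i le; apply: chain_map_below ncP _.
move=> el ew; rewrite /nc_weight el ew big_setU1 //= min1 eqxx cards1 muln1 add1n.
rewrite mulrCA !mulrA; congr (_ * _); apply: eq_bigr => A AP.
have := block_min_ge ncP AP; case: eqP => [->|_]; first by rewrite ltnn.
by rewrite muln0 mul0n.
Qed.

Lemma nc_sum_singleton c m :
  \sum_(P in NC_on (itv n x0 hi) | [set x0] \in P) nc_weight c m x0 P =
  - a m.+1 * nc_sum n (c \o succn) 0 x0.+1 hi.
Proof.
rewrite (reindex_onto (fun P => [set x0] |: P) (fun P => P :\ [set x0])) /=; last first.
  by move=> P /andP[_]; apply: setD1K.
rewrite /nc_sum mulr_sumr; apply: eq_big => [P|P]; last first.
  case/andP => /andP[ncP xP] /eqP e; apply: nc_weight_cons; rewrite -e.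
  exact: NC_uncons.
apply/idP/idP => [/andP[/andP[ncP xP] /eqP e]|ncP].
  by rewrite -e; apply: NC_uncons.
by rewrite (NC_cons lt_hi ncP) setU11 setU1K ?eqxx // (singleton_notin ncP).
Qed.

Section Successor.

Variable j : 'I_n.
Hypotheses (lt_j : (x0 < j)%N) (lt_jhi : (j < hi)%N).

(** The first block loses [x0], which the shift [m.+1] makes up for, and its chain keeps its length,
    hence the same [c]. All chains of [Q], its first one included, count with Catalan numbers. *)
Lemma nc_weight_glue c m P Q :
  Q \in NC_on (itv n x0.+1 j) -> P \in NC_on (itv n j hi) ->
  nc_weight c m x0 (glue x0 j Q P) =
  nc_weight cat_coef 0 x0.+1 Q * nc_weight c m.+1 j P.
Proof.
move=> ncQ ncP; have ncG := glueP lt_hi lt_j lt_jhi ncQ ncP.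
have [A1P jA1] := glue_block lt_jhi ncP.
have wQ := chain_map_wf (nu := fun=> 1%N) (NC_on_part ncQ).
have wP := chain_map_wf (nu := fun=> 1%N) (NC_on_part ncP).
have wG := chain_map_wf (nu := fun=> 1%N) (NC_on_part ncG).
set A1 := pblock P j in A1P jA1.
have [_ PD _ _ _] := NC_onP _ _ ncP.
have A1j x : x \in A1 -> (j <= x)%N.
  by move=> /(PD _ _ A1P); rewrite mem_itv => /andP[].
have min1 : block_min A1 = j by apply: block_min_eq.
have min2 : block_min (x0 |: A1) = x0.
  apply: block_min_eq; first exact: setU11.
  by move=> y /setU1P[->//|/A1j]; apply: leq_trans (ltnW _).
have max2 : block_max (x0 |: A1) = block_max A1.
  have /block_maxP[y [yA -> H]] := block_neq0 (NC_on_part ncP) A1P.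
  apply: block_max_eq => [|z]; first by rewrite inE yA orbT.
  by case/setU1P => [->|/H//]; apply: leq_trans (A1j _ yA); apply: ltnW.
have GE A : (A \in glue x0 j Q P) = [|| A == x0 |: A1, A \in Q | (A != A1) && (A \in P)].
  by rewrite !inE.
have [] := chain_weight_glue lt_j wG wQ wP.
- have := chain_map_block (fun=> 1%N) (NC_on_part ncG) (setU11 _ _).
  have := chain_map_block (fun=> 1%N) (NC_on_part ncP) A1P.
  by rewrite min1 min2 max2 => -> ->.
- apply: chain_map_none => A; rewrite GE => /or3P[/eqP->|AQ|/andP[ne AP]] e.
  + by move: lt_j; rewrite -e min2 ltnn.
  + by have := block_min_ge ncQ AQ; rewrite e ltnn andbF.
  + case/eqP: ne; apply: (block_min_inj (NC_on_part ncP)) => //.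
    by rewrite min1.
- by move=> i; apply: chain_map_below ncG.
- move=> i lti; apply: chain_map_eq => A Ai; rewrite GE; case: eqP => [e|_] /=.
    by move: lti; rewrite -Ai e min2 ltnn.
  case AP: (A \in P); rewrite ?andbF ?orbF //.
  by have := block_min_ge ncP AP; nat_lia.
- move=> i lti; apply: chain_map_eq => A Ai; rewrite GE; case: eqP => [e|_] /=.
    by have := lt_j; move: lti; rewrite -Ai e min2; nat_lia.
  case AQ: (A \in Q); first by have := block_min_ge ncQ AQ; nat_lia.
  rewrite /=; case: eqP => [e|_] //=.
  by move: lti; rewrite -Ai e min1 ltnn.
- by move=> i le; apply: chain_map_below ncQ _.
- move=> i le; apply: chain_map_none => A AQ Ai.
  by have := block_min_ge ncQ AQ; nat_lia.
- move=> i e w; case/chain_map_some => A [AQ _ <- _].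
  by have /andP[] := block_max_lt ncQ AQ.
- by move=> i; apply: chain_map_below ncP.
move=> el ew; rewrite /nc_weight el ew (chain_weight_first wQ (lo := x0.+1)); last first.
  by move=> i; apply: chain_map_below ncQ.
have dQ A : A \in Q -> A \notin P.
  move=> AQ; apply/negP => AP; have := block_min_ge ncQ AQ.
  by have := block_min_ge ncP AP; nat_lia.
have U : x0 |: A1 \notin Q :|: P :\ A1.
  rewrite !inE negb_or; apply/andP; split.
    by apply/negP => /(block_min_ge ncQ); rewrite min2 ltnn.
  apply/negP => /andP[_ /(block_min_ge ncP)]; rewrite min2.
  by rewrite leqNgt lt_j.
rewrite [\prod_(A in glue _ _ _ _) _]big_setU1 //= min2 eqxx muln1.
rewrite (eq_bigl (mem [predU Q & P :\ A1])) => [|A]; last by rewrite !inE.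
rewrite bigU /=; last first.
  rewrite -setI_eq0; apply/eqP/setP => A; rewrite !inE.
  by apply/negP => /and3P[/dQ/negP].
rewrite [\prod_(A in P) _](big_setD1 A1) //= min1 eqxx muln1.
rewrite cardsU1 (_ : x0 \notin A1) ?add1n ?addSnnS; last first.
  by apply/negP => /A1j; rewrite leqNgt lt_j.
(* In [Q] no block has minimum [x0], so neither side shifts any size. *)
rewrite (eq_bigr (fun A : {set 'I_n} => - a (#|A| + 0 * (block_min A == x0.+1))%N)); last first.
  move=> A AQ; have := block_min_ge ncQ AQ; case: eqP => [->|_]; first by rewrite ltnn.
  by rewrite muln0 mul0n.
(* Away from [A1] no block of [P] starts at [x0] or at [j], so neither shift takes effect. *)
rewrite [X in _ * (_ * (_ * X))](eq_bigr (fun A : {set 'I_n} => - a (#|A| + m.+1 * (block_min A == j))%N)); last first.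
  move=> A /setD1P[ne AP]; have := block_min_ge ncP AP.
  case: eqP => [->|_]; first by rewrite leqNgt lt_j.
  case: eqP => [e|_]; last by rewrite !muln0.
  by case/eqP: ne; apply: (block_min_inj (NC_on_part ncP)) => //; rewrite min1.
rewrite /cat_coef !natrM -/A1.
set u := c _; set v := _%:R; set w := _%:R; set x := _%:R; set y := - a _.
set p := \prod_(i in Q) _; set q := \prod_(i in _ :\ _) _.
rewrite -!mulrA mulrCA; congr (_ * _); rewrite mulrCA; congr (_ * _).
by rewrite [RHS]mulrCA; congr (_ * _); rewrite [RHS]mulrCA; congr (_ * _); rewrite mulrCA.
Qed.

Lemma nc_sum_succ c m :
  \sum_(P in NC_on (itv n x0 hi) | succ_in_block x0 j P) nc_weight c m x0 P =
  nc_sum n cat_coef 0 x0.+1 j * nc_sum n c m.+1 j hi.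
Proof.
rewrite (reindex_onto (fun p => glue x0 j p.1 p.2)
  (fun P => (unglue_inner x0 j P, unglue_outer x0 hi j P))) /=; last first.
  by move=> P /andP[ncP sP]; apply: (unglueK lt_hi lt_j lt_jhi).
rewrite /nc_sum mulr_suml; under [RHS]eq_bigr do rewrite mulr_sumr.
rewrite pair_big; apply: eq_big => [[Q P]|[Q P]] /=; last first.
  case/andP => /andP[nc s] /eqP[e1 e2]; apply: nc_weight_glue.
  - by have := unglue_innerP lt_hi lt_jhi nc s; rewrite e1.
  - by have := unglue_outerP lt_hi lt_j lt_jhi nc s; rewrite e2.
apply/idP/idP => [/andP[/andP[nc s] /eqP[e1 e2]]|/andP[ncQ ncP]].
  apply/andP; split.
    by have := unglue_innerP lt_hi lt_jhi nc s; rewrite e1.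
  by have := unglue_outerP lt_hi lt_j lt_jhi nc s; rewrite e2.
rewrite (glueP lt_hi lt_j lt_jhi) //= (succ_glue lt_hi lt_j lt_jhi) //=.
by rewrite (glueK lt_hi lt_j lt_jhi).
Qed.

End Successor.

Lemma nc_sum_rec c m : nc_sum n c m x0 hi =
  - a m.+1 * nc_sum n (c \o succn) 0 x0.+1 hi +
  \sum_(j < n | (x0 < j < hi)%N)
     nc_sum n cat_coef 0 x0.+1 j * nc_sum n c m.+1 j hi.
Proof.
rewrite -nc_sum_singleton {1}/nc_sum.
rewrite (bigID (fun P : {set {set 'I_n}} => [set x0] \in P)) /=; congr (_ + _).
(* For each such [P] the inner sum has exactly one term, given by the element that follows [x0] in
   its block. *)
transitivity (\sum_(P in NC_on (itv n x0 hi) | [set x0] \notin P)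
  \sum_(j < n | (x0 < j < hi)%N && succ_in_block x0 j P) nc_weight c m x0 P).
  apply: eq_bigr => P /andP[ncP nP].
  have pP := NC_on_part ncP.
  have x0c : x0 \in cover P.
    by have /and3P[/eqP-> _ _] := pP; rewrite mem_itv leqnn.
  set A0 := pblock P x0.
  have A0P : A0 \in P by apply: pblock_mem.
  have xA0 : x0 \in A0 by rewrite mem_pblock.
  have [_ PD _ _ _] := NC_onP _ _ ncP.
  have ltA y : y \in A0 :\ x0 -> (x0 < y < hi)%N.
    rewrite !inE => /andP[ne yA]; have := PD _ _ A0P yA; rewrite mem_itv.
    case/andP => le ->; rewrite andbT ltn_neqAle le andbT eq_sym.
    by apply: contraNneq ne => /val_inj->.
  (* [A0] has an element besides [x0], for otherwise it would be the excluded singleton block. *)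
  have [|j [jA _ Hj]] := @block_minP _ (A0 :\ x0).
    apply/set0Pn; apply/existsP; apply: contraR nP => /existsPn H.
    rewrite (_ : [set x0] = A0) //; apply/setP => y; rewrite inE.
    by have := H y; rewrite !inE negb_and negbK; case: eqP => [->|_ /= /negbTE->].
  rewrite (big_pred1 j) // => k; apply/idP/eqP => [|->].
    case/andP => lt /andP[kA /forall_inP H]; apply/val_inj/eqP.
    rewrite eqn_leq Hj; last by rewrite !inE kA andbT; apply: contraTneq lt => ->; rewrite ltnn.
    rewrite andbT; have [jne jA0] := setD1P jA.
    by have := H j jA0; case/andP: (ltA _ jA) => ->.
  rewrite ltA //; move: (jA); rewrite !inE /succ_in_block => /andP[_ ->] /=.
  apply/forall_inP => l lA; apply/implyP => lt; apply: Hj.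
  by rewrite !inE lA andbT; apply: contraTneq lt => ->; rewrite ltnn.
rewrite (exchange_big_dep (fun j : 'I_n => (x0 < j < hi)%N)) /=; last by move=> P j _ /andP[].
apply: eq_bigr => j /andP[lt lt']; rewrite -nc_sum_succ //.
apply: eq_bigl => P; rewrite lt lt' /=; case ncP: (P \in _) => //=.
case s: (succ_in_block x0 j P); rewrite ?andbF // andbT.
have [A0P xA jA _] := unglue_block lt_hi ncP s.
apply/negP => xP; have := jA.
rewrite (block_pblock (NC_on_part ncP) xP) ?inE // => /eqP e.
by move: lt; rewrite e ltnn.
Qed.

End Recursion.

End WeightedSums.

(** * The Catalan recurrence *)

(** The division is exact: [m.+1] divides [m * 'C(m.*2, m)], which equals [m.+1 * 'C(m.*2, m.+1)],
    and is coprime to [m]. *)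
Lemma mul_catalan m : m.+1 * catalan m = 'C(m.*2, m).
Proof.
have dv : m.+1 %| 'C(m.*2, m).
  have := mul_bin_left m.*2 m; rewrite -addnn addnK => e.
  by rewrite -(@Gauss_dvdr m.+1 m) -?e ?dvdn_mulr // coprimeSn.
by rewrite /catalan mulnC divnK.
Qed.

(** The ratio of consecutive central binomials, computed through ['C(m.*2.+1, m)]; the common factor
    [m.+1] is cancelled at the end. *)
Lemma catalanS m : m.+2 * catalan m.+1 = (m.*2.+1).*2 * catalan m.
Proof.
have H : m.+1 * 'C(m.+1.*2, m.+1) = (m.*2.+1).*2 * 'C(m.*2, m).
  have e1 := mul_bin_diag m.*2.+2 m.
  have e2 := mul_bin_down m.*2.+1 m.
  rewrite doubleS -e1 -(mul2n m.*2.+1) -mulnA e2 /= mulnA.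
  by congr (_ * _); rewrite -!muln2; lia.
apply/eqP; rewrite -(eqn_pmul2l (ltn0Sn m)); apply/eqP.
by rewrite mul_catalan H mulnCA mul_catalan.
Qed.

(* Weighting the convolution by the index and symmetrizing turns [catalanS]
   into a first-order recursion for the convolution. *)
Lemma catalan_conv n :
  catalan n.+1 = \sum_(i < n.+1) catalan i * catalan (n - i).
Proof.
pose S n := \sum_(i < n.+1) catalan i * catalan (n - i).
(* Adding the sum to its reversal gives every term the factor [i.+1 + (k - i).+1 = k.+2]. *)
have sym k : 2 * \sum_(i < k.+1) i.+1 * (catalan i * catalan (k - i)) = k.+2 * S k.
  rewrite mul2n -addnn {1}(reindex_inj rev_ord_inj) -big_split big_distrr /=.
  apply: eq_bigr => i _; have le : i <= k by rewrite -ltnS.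
  rewrite !subSS subKn // [catalan (k - i) * _]mulnC.
  by rewrite -mulnDl; congr (_ * _); lia.
(* The term [i = 0] is split off, and [catalanS] is applied to the first factor of the others. *)
have rec k : \sum_(i < k.+2) i.+1 * (catalan i * catalan (k.+1 - i)) =
    catalan k.+1 + 2 * \sum_(i < k.+1) (i.*2.+1) * (catalan i * catalan (k - i)).
  rewrite big_ord_recl subn0 /= !mul1n big_distrr; congr (_ + _).
  apply: eq_bigr => i _; rewrite /bump /= add1n subSS mulnA catalanS -mulnA.
  by rewrite [RHS]mulnA mul2n.
have H k : S k = catalan k.+1; last by rewrite -H.
elim: k => [|k IH]; first by rewrite /S big_ord_recl big_ord0.
apply/eqP; rewrite -(eqn_pmul2l (ltn0Sn k.+2)) catalanS -sym rec.
(* As [i.*2.+1] is [2 * i.+1 - 1], the sum follows from [sym] and the induction hypothesis. *)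
have -> : 2 * \sum_(i < k.+1) (i.*2.+1) * (catalan i * catalan (k - i)) =
    k.+1.*2 * catalan k.+1.
  have : 2 * \sum_(i < k.+1) (i.*2.+1) * (catalan i * catalan (k - i)) + 2 * S k
     = 2 * (2 * \sum_(i < k.+1) i.+1 * (catalan i * catalan (k - i))).
    rewrite -mulnDr; congr (2 * _); rewrite -big_split big_distrr /=.
    by apply: eq_bigr => i _; rewrite -mulSnr [RHS]mulnA -doubleS -mul2n.
  by rewrite sym IH; lia.
by apply/eqP; rewrite -!mul2n; lia.
Qed.

(** * Truncated power series *)

Local Open Scope ring_scope.

Section Truncation.

Variable R : comNzRingType.
Implicit Types (f g h : nat -> R) (p q r : {poly R}).

(** Congruence modulo ['X^N]. Series are compared through their truncations, so that the ring laws
    and composition of polynomials apply. *)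
Definition eqm N p q := forall i, (i < N)%N -> p`_i = q`_i.

Lemma eqm_refl N p : eqm N p p. Proof. by []. Qed.

Lemma eqm_sym N p q : eqm N p q -> eqm N q p.
Proof. by move=> E i /E. Qed.

Lemma eqm_trans N p q r : eqm N p q -> eqm N q r -> eqm N p r.
Proof. by move=> E E' i lt; rewrite E // E'. Qed.

Lemma eqmD N p p' q q' : eqm N p p' -> eqm N q q' -> eqm N (p + q) (p' + q').
Proof. by move=> E E' i lt; rewrite !coefD E // E'. Qed.

Lemma eqmN N p p' : eqm N p p' -> eqm N (- p) (- p').
Proof. by move=> E i lt; rewrite !coefN E. Qed.

Lemma eqmM N p p' q q' : eqm N p p' -> eqm N q q' -> eqm N (p * q) (p' * q').
Proof.
move=> E E' i lt; rewrite !coefM; apply: eq_bigr => j _.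
by have := ltn_ord j => ltj; rewrite E ?E' //; lia.
Qed.

Lemma eqm_exp N p p' k : eqm N p p' -> eqm N (p ^+ k) (p' ^+ k).
Proof. by move=> E; elim: k => // k IH; rewrite !exprS; apply: eqmM. Qed.

Lemma coef_exp_lt q k n : q`_0 = 0 -> (n < k)%N -> (q ^+ k)`_n = 0.
Proof.
move=> q0 lt; have -> : q = drop_poly 1 q * 'X.
  apply/polyP => -[|i]; first by rewrite coefMX q0.
  by rewrite coefMX coef_drop_poly addn1.
by rewrite exprMn coefMXn lt.
Qed.

(** Terms with [k > n] vanish because [q ^+ k] is divisible by ['X^k], and those with [k >= size p]
    because [p] has no such coefficient, so both ranges of summation agree. *)
Lemma coef_comp_trunc p q n : q`_0 = 0 ->
  (p \Po q)`_n = \sum_(k < n.+1) p`_k * (q ^+ k)`_n.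
Proof.
move=> q0; rewrite coef_comp_poly.
pose F k := p`_k * (q ^+ k)`_n.
have F0 M M' : (M <= M')%N -> (forall k, (M <= k)%N -> F k = 0) ->
    \sum_(k < M') F k = \sum_(k < M) F k.
  move=> le H; rewrite -!(big_mkord xpredT) (big_cat_nat (n := M)) //=.
  rewrite -[RHS]addr0; congr (_ + _).
  by rewrite big_nat big1 // => k /andP[/H].
have Fn k : (n < k)%N -> F k = 0 by move=> lt; rewrite /F coef_exp_lt ?mulr0.
have Fs k : (size p <= k)%N -> F k = 0 by move=> le; rewrite /F nth_default ?mul0r.
case: (leqP (size p) n.+1) => le; first by rewrite -(F0 _ _ le).
by rewrite (F0 _ _ (ltnW le)).
Qed.

Lemma eqm_comp N p p' q q' : q`_0 = 0 -> q'`_0 = 0 ->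
  eqm N p p' -> eqm N q q' -> eqm N (p \Po q) (p' \Po q').
Proof.
move=> q0 q'0 E E' n lt; rewrite !coef_comp_trunc //; apply: eq_bigr => k _.
by rewrite E ?(eqm_exp _ E') //; have := ltn_ord k; lia.
Qed.

Definition trunc N f : {poly R} := \poly_(i < N) f i.

Lemma coef_trunc N f i : (i < N)%N -> (trunc N f)`_i = f i.
Proof. by move=> lt; rewrite coef_poly lt. Qed.

Lemma trunc_coef0 N f : f 0%N = 0 -> (trunc N f)`_0 = 0.
Proof. by move=> f0; rewrite coef_poly f0 if_same. Qed.

Lemma coef_fps_exp N f k i : (i < N)%N -> fps_exp f k i = (trunc N f ^+ k)`_i.
Proof.
elim: k i => [|k IH] i lt; first by rewrite expr0 coef1.
rewrite /fps_exp iterS exprS coefM; apply: eq_bigr => j _.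
by have := ltn_ord j => ltj; rewrite coef_trunc ?[fps_exp _ _]IH -?IH //; lia.
Qed.

Lemma coef_fps_comp N f g i : g 0%N = 0 -> (i < N)%N ->
  fps_comp f g i = (trunc N f \Po trunc N g)`_i.
Proof.
move=> g0 lt; rewrite coef_comp_trunc ?trunc_coef0 //; apply: eq_bigr => k _.
by rewrite coef_trunc -?coef_fps_exp //; have := ltn_ord k; lia.
Qed.

Lemma trunc_fps_comp N f g : g 0%N = 0 ->
  eqm N (trunc N (fps_comp f g)) (trunc N f \Po trunc N g).
Proof. by move=> g0 i lt; rewrite coef_trunc // (coef_fps_comp _ _ lt). Qed.

Lemma trunc_X N : eqm N (trunc N (@fps_X R)) 'X.
Proof. by move=> i lt; rewrite coef_trunc // coefX. Qed.

Lemma fps_comp0 f g : g 0%N = 0 -> fps_comp f g 0%N = f 0%N.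
Proof. by move=> g0; rewrite /fps_comp big_ord1 /fps_exp /= mulr1. Qed.

(** The coefficient of index [n] depends only on truncations at [n.+1], where the law is
    [comp_polyA]. *)
Lemma fps_compA f g h : g 0%N = 0 -> h 0%N = 0 ->
  fps_comp f (fps_comp g h) =1 fps_comp (fps_comp f g) h.
Proof.
move=> g0 h0 n; have gh0 : fps_comp g h 0%N = 0 by rewrite fps_comp0.
rewrite (@coef_fps_comp n.+1 f) // (@coef_fps_comp n.+1 _ h) //.
have h0' : (trunc n.+1 h)`_0 = 0 by apply: trunc_coef0.
have g0' : (trunc n.+1 g)`_0 = 0 by apply: trunc_coef0.
have gh0' : (trunc n.+1 g \Po trunc n.+1 h)`_0 = 0.
  by rewrite coef_comp_trunc // big_ord1 g0' mul0r.
transitivity ((trunc n.+1 f \Po (trunc n.+1 g \Po trunc n.+1 h))`_n).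
  by apply: (@eqm_comp n.+1) => //; [apply: trunc_coef0|apply: trunc_fps_comp].
rewrite comp_polyA; apply: (@eqm_comp n.+1) => //.
exact/eqm_sym/trunc_fps_comp.
Qed.

Lemma fps_compX f : fps_comp f (@fps_X R) =1 f.
Proof.
move=> n; rewrite (@coef_fps_comp n.+1) // (@eqm_comp n.+1 _ (trunc n.+1 f) _ 'X) //.
- by rewrite comp_polyXr coef_trunc.
- exact: trunc_coef0.
- by rewrite coefX.
- exact: trunc_X.
Qed.

Lemma fps_Xcomp f : f 0%N = 0 -> fps_comp (@fps_X R) f =1 f.
Proof.
move=> f0 n; rewrite (@coef_fps_comp n.+1) // (@eqm_comp n.+1 _ 'X _ (trunc n.+1 f)) //.
- by rewrite comp_polyX coef_trunc.
- exact: trunc_coef0.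
- exact: trunc_coef0.
- exact: trunc_X.
Qed.

Lemma eq_fps_comp f f' g g' : f =1 f' -> g =1 g' -> fps_comp f g =1 fps_comp f' g'.
Proof.
move=> ef eg n; apply: eq_bigr => k _; rewrite ef; congr (_ * _).
rewrite !(@coef_fps_exp n.+1) // /trunc.
by under eq_poly => i _ do rewrite eg.
Qed.

End Truncation.

(** * From the recursion to the functional equation *)

Section Inversion.

Variables (R : comNzRingType) (a : nat -> R).

Local Notation cat := (cat_coef R).

Lemma nc_sum_recS n c m lo k : (lo + k.+1 <= n)%N ->
  nc_sum a n c m lo (lo + k.+1) =
  - a m.+1 * nc_sum a n (c \o succn) 0 lo.+1 (lo.+1 + k) +
  \sum_(i < k) nc_sum a n cat 0 lo.+1 (lo.+1 + i) *
               nc_sum a n c m.+1 (lo.+1 + i) (lo.+1 + i + (k - i)).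
Proof.
move=> le; have lt : (lo < n)%N by lia.
have := @nc_sum_rec R a n (Ordinal lt) (lo + k.+1) _ c m; rewrite /= => -> //; last by lia.
rewrite addSnnS; congr (_ + _).
rewrite -(big_ord_widen_cond n
  (fun j : nat => (lo < j)%N)
  (fun j => nc_sum a n cat 0 lo.+1 j * nc_sum a n c m.+1 j (lo + k.+1))) //.
rewrite -(big_mkord (fun j : nat => (lo < j)%N)
  (fun j => nc_sum a n cat 0 lo.+1 j * nc_sum a n c m.+1 j (lo + k.+1))).
rewrite (big_cat_nat (n := lo.+1)) //=; last by lia.
rewrite big_nat_cond big1 ?add0r => [|i]; last by lia.
rewrite -{1}[lo.+1]add0n big_addn -addSnnS addKn big_mkord.
apply: eq_big => [i|i _]; first by rewrite addnC; lia.
rewrite addnC; congr (_ * nc_sum a n c _ _ _).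
by have := ltn_ord i; lia.
Qed.

Definition nc_total c m k := nc_sum a k c m 0 k.

(** The recursion only involves lengths of intervals, so neither the position [lo] nor the ambient
    [n] matters. *)
Lemma nc_sum_shift k n lo c m : (lo + k <= n)%N ->
  nc_sum a n c m lo (lo + k) = nc_total c m k.
Proof.
rewrite /nc_total; elim/ltn_ind: k n lo c m => -[|k] IH n lo c m le.
  by rewrite addn0 !nc_sum_empty.
rewrite nc_sum_recS // -[X in _ = nc_sum _ _ _ _ _ X]add0n nc_sum_recS //.
congr (- a _ * _ + _); first by rewrite !IH //; lia.
apply: eq_bigr => i _; have := ltn_ord i => lti.
by congr (_ * _); rewrite !IH //; lia.
Qed.

Lemma nc_total0 c m : nc_total c m 0 = c 0%N.
Proof. exact: nc_sum_empty. Qed.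

Lemma nc_totalS c m k :
  nc_total c m k.+1 = - a m.+1 * nc_total (c \o succn) 0 k +
  \sum_(i < k) nc_total cat 0 i * nc_total c m.+1 (k - i).
Proof.
rewrite {1}/nc_total -[X in nc_sum _ _ _ _ _ X]add0n nc_sum_recS //.
congr (- a _ * _ + _); first by rewrite nc_sum_shift.
apply: eq_bigr => i _; have := ltn_ord i => lti.
by rewrite !nc_sum_shift //; lia.
Qed.

Definition inv_coef k := nc_total cat 0 k.

Section FixedPoint.

Variable N : nat.

Let W := trunc N inv_coef.

(** The series of a block of [k.+1] elements, with its [k] gaps filled and its size shifted by [m];
    for [m = 0] this is U. *)
Definition block_series m : {poly R} :=
  \sum_(k < N) a (k.+1 + m)%N *: ('X^(k.+1) * W ^+ k).

Definition chain_series (c : nat -> R) : {poly R} :=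
  trunc N c \Po - block_series 0.

Lemma block_series0 m : (block_series m)`_0 = 0.
Proof.
by rewrite coef_sum big1 // => k _; rewrite coefZ coefXnM mulr0.
Qed.

(** A block is a single element, or an element followed by a filled gap and a block whose size is
    shifted once more. *)
Lemma block_series_rec m : eqm N (block_series m)
  (a m.+1 *: 'X + 'X * W * block_series m.+1).
Proof.
move=> i lt.
have -> : a m.+1 *: 'X + 'X * W * block_series m.+1 =
    \sum_(k < N.+1) a (k.+1 + m)%N *: ('X^(k.+1) * W ^+ k).
  rewrite big_ord_recl /= expr0 mulr1 add1n; congr (_ + _).
  rewrite /block_series mulr_sumr; apply: eq_bigr => k _.
  rewrite /bump /= add1n addSnnS -scalerAr; congr (a _ *: _); first by lia.
  by rewrite !exprS; ring.
(* The extra last term is divisible by ['X^(N.+1)]. *)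
rewrite big_ord_recr coefD [X in _ = _ + X](_ : _ = 0) ?addr0 //.
by rewrite coefZ coefXnM leqW // mulr0.
Qed.

Lemma chain_series_rec c : eqm N (chain_series c)
  ((c 0%N)%:P - block_series 0 * chain_series (c \o succn)).
Proof.
have u0 : (- block_series 0)`_0 = 0 by rewrite coefN block_series0 oppr0.
have -> : (c 0%N)%:P - block_series 0 * chain_series (c \o succn) =
  ((c 0%N)%:P + 'X * trunc N (c \o succn)) \Po - block_series 0.
  by rewrite comp_polyD comp_polyC comp_polyM comp_polyX mulNr.
apply: eqm_comp => // i lt; rewrite coef_trunc // coefD coefC coefXM.
by case: i lt => [|i] lt; rewrite ?addr0 //= add0r coef_trunc // ltnW.
Qed.

(** Splitting off the first block, of series [block_series m], leaves a chain shorter by one, whence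
    [c \o succn]. The induction matches [nc_totalS] with [block_series_rec]. *)
Lemma nc_total_coef k c m : (k < N)%N ->
  nc_total c m k = ((c 0%N)%:P - block_series m * chain_series (c \o succn))`_k.
Proof.
elim/ltn_ind: k c m => -[|k] IH c m lt.
  by rewrite nc_total0 coefB coefC /= coef0M block_series0 mul0r subr0.
set G := chain_series (c \o succn).
rewrite nc_totalS coefB coefC sub0r.
rewrite (eqmM (block_series_rec m) (@eqm_refl _ _ G)) //.
rewrite mulrDl -scalerAl -!mulrA coefD coefZ !coefXM /=.
rewrite (chain_series_rec _ (ltnW lt)) -(IH k) ?(ltnW lt) //.
rewrite opprD -mulNr; congr (_ + _).
(* The convolution has one more term, [i = k], which vanishes with the constant coefficient of the
   block series. *)
rewrite coefM big_ord_recr /= subnn coef0M block_series0 mul0r mulr0 addr0.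
rewrite -sumrN; apply: eq_bigr => i _; have := ltn_ord i => lti.
rewrite coef_trunc; last by lia.
rewrite (IH (k - i)%N); [|lia|lia].
(* As [k - i] is positive, the constant [c 0] does not contribute. *)
rewrite coefB coefC subn_eq0 leqNgt lti /= sub0r mulrN.
by [].
Qed.

Lemma inv_coef_eq : eqm N W (1 - block_series 0 * W ^+ 2).
Proof.
have u0 : (- block_series 0)`_0 = 0 by rewrite coefN block_series0 oppr0.
have WG : eqm N W (chain_series cat).
  move=> i lt; rewrite coef_trunc // /inv_coef nc_total_coef //.
  by rewrite -chain_series_rec.
apply: (eqm_trans WG).
apply: (@eqm_trans _ _ _ (1 - block_series 0 * chain_series cat ^+ 2)); last first.
  apply: eqmD => //; apply: eqmN; apply: eqmM => //.
  by apply: eqm_exp; apply: eqm_sym.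
(* The Catalan equation C = 1 + t C^2, known modulo t^N by [catalan_conv], is evaluated at t =
   -U. *)
have -> : 1 - block_series 0 * chain_series cat ^+ 2 =
    (1 + 'X * trunc N cat ^+ 2) \Po - block_series 0.
  by rewrite comp_polyD comp_polyM comp_polyX rmorph1 rmorphXn mulNr.
apply: eqm_comp => // i lt; rewrite coef_trunc // coefD coef1 coefXM.
case: i lt => [|i] lt /=; first by rewrite addr0 /cat_coef.
rewrite add0r expr2 coefM /cat_coef catalan_conv natr_sum.
apply: eq_bigr => k _; have := ltn_ord k => ltk.
by rewrite natrM !coef_trunc //; lia.
Qed.

End FixedPoint.

Lemma right_inverse : fps_comp (unit_series a) (unit_series inv_coef) =1 @fps_X R.
Proof.
move=> n; set N := n.+1; rewrite (@coef_fps_comp _ N) //.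
set W := trunc N inv_coef.
have h : eqm N (trunc N (unit_series inv_coef)) ('X * W).
  move=> [|[|i]] lt; rewrite coef_trunc // coefXM //= coef_trunc ?(ltnW lt) //.
  by rewrite /inv_coef nc_total0.
have g : eqm N (trunc N (unit_series a)) ('X + \sum_(k < N) a k.+1 *: 'X^(k.+2)).
  move=> i lt; rewrite coef_trunc // coefD coefX coef_sum.
  case: i lt => [|[|i]] lt /=.
  - by rewrite big1 ?addr0 // => k _; rewrite coefZ coefXn mulr0.
  - by rewrite big1 ?addr0 // => k _; rewrite coefZ coefXn mulr0.
  have lti : (i < N)%N by lia.
  rewrite add0r (bigD1 (Ordinal lti)) //= coefZ coefXn eqxx mulr1 big1 ?addr0 //.
  move=> k ne; rewrite coefZ coefXn [_ == _](_ : _ = false) ?mulr0 //.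
  by apply/negbTE; apply: contraNneq ne => -[e]; apply/eqP/val_inj.
rewrite (eqm_comp _ _ g h) ?trunc_coef0 ?coefXM //.
rewrite comp_polyD comp_polyX raddf_sum /=.
(* Each power of xW of exponent k + 2 is x times the factor x^(k+1) W^k of U times W^2. *)
have -> : \sum_(k < N) ((a k.+1 *: 'X^(k.+2)) \Po ('X * W)) =
    'X * (block_series N 0 * W ^+ 2).
  rewrite mulr_suml mulr_sumr; apply: eq_bigr => k _.
  rewrite comp_polyZ comp_Xn_poly addn0 -scalerAl -scalerAr; congr (_ *: _).
  by rewrite exprMn !exprS; ring.
rewrite -mulrDr.
have e : eqm N (W + block_series N 0 * W ^+ 2) 1.
  move=> i lt; have := inv_coef_eq lt; rewrite coefD -/W => ->.
  by rewrite coefB subrK.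
by rewrite (eqmM (@eqm_refl _ N 'X) e) // mulr1 coefX.
Qed.

End Inversion.

(** * Two-sided inverse, uniqueness and the explicit coefficients *)

Lemma eq_unit_series (R : comNzRingType) (a b : nat -> R) :
  (forall n, (0 < n)%N -> a n = b n) -> unit_series a =1 unit_series b.
Proof. by move=> E [|[|n]] //=; apply: E. Qed.

(* The right inverse [h] of [g] has itself a right inverse [k], and
   [g = g o (h o k) = (g o h) o k = k]. *)
Lemma inverse_unit_series (R : comNzRingType) (a : nat -> R) :
  compositional_inverse (unit_series a) (unit_series (inv_coef a)).
Proof.
split; first exact: right_inverse.
set g := unit_series a; set h := unit_series _.
pose k := unit_series (inv_coef (inv_coef a)).
have gh : fps_comp g h =1 @fps_X R := right_inverse a.
have hk : fps_comp h k =1 @fps_X R := right_inverse (inv_coef a).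
have gk : g =1 k.
  move=> n; rewrite -(fps_compX g n) -(eq_fps_comp (frefl g) hk n) fps_compA //.
  by rewrite (eq_fps_comp gh (frefl k) n) fps_Xcomp.
by move=> n; rewrite (eq_fps_comp (frefl h) gk n) hk.
Qed.

Lemma compositional_inverse_unique (R : comNzRingType) (g h k : nat -> R) :
  g 0%N = 0 -> h 0%N = 0 -> k 0%N = 0 ->
  compositional_inverse g h -> compositional_inverse g k -> h =1 k.
Proof.
move=> g0 h0 k0 [_ hg] [gk _] n.
rewrite -(fps_compX h n) -(eq_fps_comp (frefl h) gk n) fps_compA //.
by rewrite (eq_fps_comp hg (frefl k) n) fps_Xcomp.
Qed.

Lemma inv_coefE (R : comNzRingType) (a : nat -> R) n :
  inv_coef a n = \sum_(P in NC n)
    (-1) ^+ #|P| * (catalan_closure P)%:R * \prod_(A in P) a #|A|.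
Proof.
have e : itv n 0 n = [set: 'I_n] by apply/setP => i; rewrite !inE ltn_ord.
rewrite /inv_coef /nc_total /nc_sum e -/(NC n).
apply: eq_bigr => P ncP; have pP := NC_on_part ncP.
have wf := chain_map_wf (nu := fun=> 1%N) pP.
(* The chain from the least element 0 is split off, its Catalan factor being the value of [cat_coef]
   in [nc_weight]. *)
rewrite (catalan_closureE pP) (chain_weight_first wf (lo := 0)) //.
rewrite /nc_weight /cat_coef natrM -[RHS]mulrA mulrCA; congr (_ * _).
rewrite prodrN; congr (_ * _); apply: eq_bigr => A _.
by rewrite mul0n addn0.
Qed.

Theorem theorem5p4 (R : comNzRingType) (a b : nat -> R) :
  compositional_inverse (unit_series a) (unit_series b) <->
  (forall n : nat, (0 < n)%N ->
     b n = \sum_(P in NC n)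
             (-1) ^+ #|P| * (catalan_closure P)%:R * \prod_(A in P) a #|A|).
Proof.
have inv := inverse_unit_series a; split=> [ab [|n] // _|E].
  rewrite -inv_coefE.
  (* The coefficient of [unit_series b] at [n.+2] is [b n.+1]. *)
  exact: (compositional_inverse_unique _ _ _ ab inv n.+2).
have eb : unit_series b =1 unit_series (inv_coef a).
  by apply: eq_unit_series => n /E; rewrite -inv_coefE.
case: inv => i1 i2; split=> n.
  by rewrite (eq_fps_comp (frefl _) eb n) i1.
by rewrite (eq_fps_comp eb (frefl _) n) i2.
Qed.
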